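(* Consider the hierarchical Bayesian linear regression model described in the context, with a fixed number $p$ of potential predictors and a sequence of design matrices $\mathbf{X}=\mathbf{X}^{(n)}\in\mathbb{R}^{n\times p}$. Suppose the data are generated by the true model $M_{\mathcal{A}}$, i.e. $\mathbf{y}=\mathbf{X}_{\mathcal{A}}\boldsymbol\beta_{\mathcal{A}}+\boldsymbol\varepsilon$ with $\boldsymbol\varepsilon\sim\mathcal{N}(\mathbf{0},\sigma^2\mathrm{I}_n)$, for some nonempty $\mathcal{A}\subseteq\{1,\dots,p\}$, a coefficient vector $\boldsymbol\beta_{\mathcal{A}}$ and $\sigma^2>0$. Assume that for every nonempty $\mathcal{A}'\subseteq\{1,\dots,p\}$ such that $\mathcal{A}\not\subseteq\mathcal{A}'$ (i.e. $M_{\mathcal{A}'}$ does not nest $M_{\mathcal{A}}$), $$\lim_{n\to\infty}\frac{\boldsymbol\beta_{\mathcal{A}}^T\mathbf{X}_{\mathcal{A}}^T\big(\mathrm{I}_n-\mathbf{X}_{\mathcal{A}'}(\mathbf{X}_{\mathcal{A}'}^T\mathbf{X}_{\mathcal{A}'})^{-1}\mathbf{X}_{\mathcal{A}'}^T\big)\mathbf{X}_{\mathcal{A}}\boldsymbol\beta_{\mathcal{A}}}{n}=b_{\mathcal{A}'}\in(0,\infty).$$ Then the model is consistent in terms of model selection: $$\operatorname*{p\,lim}_{n\to\infty} p(M_{\mathcal{A}}\mid\mathbf{y},\mathbf{X})=1\quad\text{and}\quad \operatorname*{p\,lim}_{n\to\infty} p(M_{\mathcal{A}'}\mid\mathbf{y},\mathbf{X})=0\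 \text{ for all nonempty }\mathcal{A}'\neq\mathcal{A},$$ where the probability limits are taken with respect to the true sampling distribution $\mathbf{y}=\mathbf{X}_{\mathcal{A}}\boldsymbol\beta_{\mathcal{A}}+\boldsymbol\varepsilon$.
   Context: Setting: linear regression $\mathbf{y}=\mathbf{X}\boldsymbol\beta+\boldsymbol\varepsilon$ with $n$-dimensional zero-centered response $\mathbf{y}$, design matrix $\mathbf{X}=(\mathbf{x}_1,\dots,\mathbf{x}_p)\in\mathbb{R}^{n\times p}$ whose columns are zero-centered with $\|\mathbf{x}_j\|^2=n-1$, and it is assumed that no predictor is an exact linear combination of the other predictors. For $\mathcal{A}\subseteq\{1,\dots,p\}$, $\mathbf{X}_{\mathcal{A}}$ is the submatrix of columns with indices in $\mathcal{A}$, $\boldsymbol\beta_{\mathcal{A}}$ the corresponding coefficients, $\boldsymbol\beta_{\mathcal{A}^C}$ the remaining ones, and $k=|\mathcal{A}|$; the model $M_{\mathcal{A}}$ is the one in which exactly the coefficients with indices in $\mathcal{A}$ may be nonzero (it is identified with $\mathcal{A}$, so $p(M_{\mathcal{A}}\mid\mathbf{y},\mathbf{X})=p(\mathcal{A}\mid\mathbf{y},\mathbf{X})$). The hierarchical model is: $\mathbf{y}\mid\mathbf{X},\boldsymbol\beta,\sigma^2\sim\mathcal{N}(\mathbf{X}\boldsymbol\beta,\sigma^2\mathrm{I}_n)$; $p(\boldsymbol\beta\mid\mathcal{A},g,\sigma^2,\mathbf{X}_{\mathcal{A}})\propto\exp\!\big(-\tfrac12\boldsymbol\beta_{\mathcal{A}}^T(g^{-1}\sigma^{-2}\mathbf{X}_{\mathcal{A}}^T\mathbf{X}_{\mathcal{A}}+\lambda\mathrm{I}_k)\boldsymbol\beta_{\mathcal{A}}\big)\,h(\boldsymbol\beta_{\mathcal{A}^C})$,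 where $h(\boldsymbol\beta_{\mathcal{A}^C})=1$ if $\boldsymbol\beta_{\mathcal{A}^C}=\mathbf{0}$ and $0$ otherwise, and $\lambda=\max(1/k,1/300)$ if $n\le\zeta$ and $\lambda=0$ if $n>\zeta$, for a fixed sufficiently large constant $\zeta$; the random nonempty set $\mathcal{A}=\{\alpha_1,\dots,\alpha_k\}\subseteq\{1,\dots,p\}$ has prior $p(\mathcal{A})\propto(p_{\alpha_1}+\dots+p_{\alpha_k})\frac1k\tilde p(k)$, where $p_1,\dots,p_p\ge0$ with $\sum_i p_i=1$ and $\tilde p:\{1,\dots,p\}\to[0,\infty)$ are fixed hyperparameters (not depending on $n$); $g\sim\mathrm{IG}(1/2,n/2)$ (inverse gamma, shape $1/2$, scale $n/2$); $\sigma^2\sim\mathrm{IG}(a,b)$ with fixed $a,b>0$. $\operatorname{p\,lim}$ denotes limit in probability.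
   Formalization: The true model is additionally assumed to have positive prior mass, p(A) > 0 (otherwise its posterior probability is always 0 and the claim fails); the design conditions on X are required only for all sufficiently large n, since they cannot hold for n ≤ p. *)

(* Defs.v *)
From HB Require Import structures.
From mathcomp Require Import all_boot all_order all_algebra.
From mathcomp Require Import all_classical all_reals all_analysis.
Import Order.TTheory GRing.Theory Num.Theory.
Import numFieldNormedType.Exports.
Local Open Scope classical_set_scope.
Local Open Scope ring_scope.

Section BayesDefs.
Context {R : realType}.

(** Lebesgue integral over R^k (column vectors), as an iterated integral
    of a nonnegative extended-real function (Tonelli). *)
Fixpoint iint {k : nat} : ('cV[R]_k -> \bar R) -> \bar R :=
  match k return ('cV[R]_k -> \bar R) -> \bar R with
  | 0 => fun f => f 0
  | k'.+1 => fun f =>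
      (\int[@lebesgue_measure R]_x
         iint (fun v : 'cV[R]_k' => f (col_mx (x%:M : 'M[R]_1) v)))%E
  end.

Definition posR : set R := [set x | 0 < x].

Definition sqnorm {n : nat} (v : 'cV[R]_n) : R := \sum_i (v i 0) ^+ 2.

Definition subcols {n p : nat} (M : 'M[R]_(n, p)) (S : {set 'I_p})
  : 'M[R]_(n, #|S|) := \matrix_(i, j) M i (enum_val j).

Definition gauss_pdf {n : nat} (s2 : R) (e : 'cV[R]_n) : R :=
  (2 * pi * s2) `^ (- (n%:R / 2)) * expR (- (sqnorm e / (2 * s2))).

Definition ig_kernel (al be x : R) : R :=
  if 0 < x then x `^ (- al - 1) * expR (- (be / x)) else 0.
Definition ig_pdf (al be x : R) : R :=
  ig_kernel al be x /
  fine (\int[@lebesgue_measure R]_(t in posR) (ig_kernel al be t)%:E)%E.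

Definition lam (zeta n k : nat) : R :=
  if (n <= zeta)%N then Num.max (k%:R)^-1 (300%:R)^-1 else 0.

Definition Qprec (zeta : nat) {n p : nat} (X : 'M[R]_(n, p)) (S : {set 'I_p}) (g s2 : R)
  : 'M[R]_#|S| :=
  (g * s2)^-1 *: ((subcols X S)^T *m subcols X S) + (lam zeta n #|S|)%:M.

(** unnormalized prior kernel of beta_S (beta_{S^C} = 0) *)
Definition beta_kernel (zeta : nat) {n p : nat} (X : 'M[R]_(n, p)) (S : {set 'I_p})
  (g s2 : R) (b : 'cV[R]_#|S|) : R :=
  expR (- ((b^T *m Qprec zeta X S g s2 *m b) 0 0 / 2)).

Definition beta_pdf (zeta : nat) {n p : nat} (X : 'M[R]_(n, p)) (S : {set 'I_p})
  (g s2 : R) (b : 'cV[R]_#|S|) : R :=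
  beta_kernel zeta X S g s2 b /
  fine (iint (fun c => (beta_kernel zeta X S g s2 c)%:E)).

Definition marg (a b : R) (zeta : nat) {n p : nat} (X : 'M[R]_(n, p))
  (y : 'cV[R]_n) (S : {set 'I_p}) : \bar R :=
  (\int[@lebesgue_measure R]_(g in posR)
    \int[@lebesgue_measure R]_(s2 in posR)
      (iint (fun c : 'cV[R]_#|S| =>
         (gauss_pdf s2 (y - subcols X S *m c) * beta_pdf zeta X S g s2 c)%:E)
       * (ig_pdf (2%:R)^-1 (n%:R / 2) g * ig_pdf a b s2)%:E))%E.

Definition prior_kernel {p : nat} (pw : 'I_p -> R) (pt : nat -> R)
  (S : {set 'I_p}) : R :=
  (\sum_(i in S) pw i) * (#|S|%:R)^-1 * pt #|S|.

Definition prior_model {p : nat} (pw : 'I_p -> R) (pt : nat -> R)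
  (S : {set 'I_p}) : R :=
  prior_kernel pw pt S / \sum_(S' : {set 'I_p} | S' != finset.set0) prior_kernel pw pt S'.

Definition post (a b : R) (zeta : nat) {p : nat} (pw : 'I_p -> R) (pt : nat -> R)
  {n : nat} (X : 'M[R]_(n, p)) (y : 'cV[R]_n) (S : {set 'I_p}) : R :=
  fine ((prior_model pw pt S)%:E * marg a b zeta X y S)%E /
  fine (\sum_(S' : {set 'I_p} | S' != finset.set0)
          ((prior_model pw pt S')%:E * marg a b zeta X y S'))%E.

Definition gauss_prob {n : nat} (s2 : R) (Z : 'cV[R]_n -> bool) : \bar R :=
  iint (fun e => (gauss_pdf s2 e * (Z e)%:R)%:E).

Definition resid_quad {n p : nat} (X : 'M[R]_(n, p)) (A : {set 'I_p})
  (bA : 'cV[R]_#|A|) (A' : {set 'I_p}) : R :=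
  let v := subcols X A *m bA in
  let X' := subcols X A' in
  (v^T *m (1%:M - X' *m invmx (X'^T *m X') *m X'^T) *m v) 0 0.

End BayesDefs.

(* Main.v *)
Require Import Defs.
From HB Require Import structures.
From mathcomp Require Import all_boot all_order all_algebra.
From mathcomp Require Import all_classical all_reals all_analysis.
From mathcomp Require Import measurable_realfun ring lra zify.
Import Order.TTheory GRing.Theory Num.Theory.
Import numFieldNormedType.Exports.
Local Open Scope classical_set_scope.
Local Open Scope ring_scope.

Set Implicit Arguments.
Unset Strict Implicit.
Unset Printing Implicit Defensive.

(** Integrating out the coefficients (a Gaussian integral, by completing the
    square) and the variance (a rescaled inverse-gamma integral) gives, once
    [n > zeta], the marginal likelihood of a model of size [k] up to a factor
    common to all models:
    [\int g^(-3/2) exp (- n / 2g) (1 + g)^(-k/2) F(g)^(-(n/2 + a)) dg],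
    where [F(g) = b + (r + (s - r) / (1 + g)) / 2], [s = |y|^2] and [r] is the
    residual sum of squares of the model.

    If a model misses part of the truth, its [r] exceeds the true one by a
    multiple of [n] with high probability, so its evidence is exponentially
    smaller, while the factors that depend on [g] only cost a power of [n].
    If it strictly contains the truth, its [r] is smaller by at most
    [|P' e|^2 = O_P(1)], so the power of [F] changes by a bounded factor; since
    the prior of [g] puts exponentially small mass on bounded sets and [F]
    decreases in [g], the extra factor [(1 + g)^(-1/2)] makes the ratio vanish.

    The probabilities involved are bounded by Markov's inequality, with every
    second moment replaced by exponential moments through
    [z^2 <= 4 (exp z + exp (- z))], so that only translated and rescaled Gaussian
    densities are ever integrated. *)

(** * Monotonicity and linearity of iterated Lebesgue integrals *)

Section IteratedIntegral.
Context {R : realType}.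
Local Notation mu := (@lebesgue_measure R).

(* No measurability is needed: the integral of a nonnegative function is the
   supremum of the integrals of the simple functions below it. *)
Lemma le_integralT_ge0 (f g : R -> \bar R) :
  (forall x, 0 <= f x)%E -> (forall x, f x <= g x)%E ->
  (\int[mu]_x f x <= \int[mu]_x g x)%E.
Proof.
move=> f0 fg; have g0 x : (0 <= g x)%E := le_trans (f0 x) (fg x).
rewrite !ge0_integralTE//; apply: ereal_sup_le => _ [h hf <-].
by exists h => // x; exact: le_trans (hf x) (fg x).
Qed.

Lemma iint_ge0 k (f : 'cV[R]_k -> \bar R) :
  (forall v, 0 <= f v)%E -> (0 <= iint f)%E.
Proof.
elim: k f => [|k IH] f f0 /=; first exact: f0.
by apply: integral_ge0 => x _; exact: IH.
Qed.

Lemma le_iint k (f g : 'cV[R]_k -> \bar R) :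
  (forall v, 0 <= f v)%E -> (forall v, f v <= g v)%E -> (iint f <= iint g)%E.
Proof.
elim: k f g => [|k IH] f g f0 fg /=; first exact: fg.
by apply: le_integralT_ge0 => x; [exact: iint_ge0|exact: IH].
Qed.

Lemma eq_iint k (f g : 'cV[R]_k -> \bar R) : f =1 g -> iint f = iint g.
Proof. by move=> /funext ->. Qed.

(* Tonelli measurability, level by level: exactly what additivity of [iint]
   requires. *)
Fixpoint iint_nice {k : nat} : ('cV[R]_k -> \bar R) -> Prop :=
  match k return ('cV[R]_k -> \bar R) -> Prop with
  | 0 => fun f => (0 <= f 0%R)%E
  | k'.+1 => fun f =>
      (forall x : R, iint_nice (fun v : 'cV[R]_k' => f (col_mx (x%:M : 'M[R]_1) v))) /\
      measurable_fun [set: R]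
        ((fun x => iint (fun v : 'cV[R]_k' => f (col_mx (x%:M : 'M[R]_1) v)))
         : R -> \bar R)
  end.

Lemma iint_nice_ge0 k (f : 'cV[R]_k -> \bar R) : iint_nice f -> (0 <= iint f)%E.
Proof.
elim: k f => [|k IH] f //= [nf _].
by apply: integral_ge0 => x _; exact: IH.
Qed.

Lemma iint_niceD k (f g : 'cV[R]_k -> \bar R) :
  iint_nice f -> iint_nice g ->
  iint_nice (fun v => f v + g v)%E /\
  iint (fun v => f v + g v)%E = (iint f + iint g)%E.
Proof.
elim: k f g => [|k IH] f g /=; first by move=> f0 g0; split => //; exact: adde_ge0.
move=> [nf mf] [ng mg]; have H x := IH _ _ (nf x) (ng x).
have E x : iint (fun v : 'cV_k => f (col_mx x%:M v) + g (col_mx x%:M v))%E =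
  (iint (fun v : 'cV_k => f (col_mx x%:M v)) +
   iint (fun v : 'cV_k => g (col_mx x%:M v)))%E := (H x).2.
split.
  split; first by move=> x; exact: (H x).1.
  by under eq_fun do rewrite E; exact: emeasurable_funD.
under eq_integral do rewrite E.
by rewrite ge0_integralD// => x _; exact: iint_nice_ge0.
Qed.

Lemma iint_niceZ k (c : R) (f : 'cV[R]_k -> \bar R) : 0 <= c ->
  iint_nice f ->
  iint_nice (fun v => c%:E * f v)%E /\ iint (fun v => c%:E * f v)%E = (c%:E * iint f)%E.
Proof.
move=> c0; elim: k f => [|k IH] f /=; first by move=> f0; split => //; exact: mule_ge0.
move=> [nf mf]; have H x := IH _ (nf x).
have E x : iint (fun v : 'cV_k => c%:E * f (col_mx x%:M v))%E =
  (c%:E * iint (fun v : 'cV_k => f (col_mx x%:M v)))%E := (H x).2.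
split.
  split; first by move=> x; exact: (H x).1.
  by under eq_fun do rewrite E; exact: measurable_funeM.
under eq_integral do rewrite E.
by rewrite ge0_integralZl// => x _; exact: iint_nice_ge0.
Qed.

Lemma iint_nice0 k : iint_nice (fun _ : 'cV[R]_k => 0%E) /\
  iint (fun _ : 'cV[R]_k => 0%E) = 0%E.
Proof.
elim: k => [|k [IH E]] //=; rewrite E; split; last exact: integral0.
by split.
Qed.

End IteratedIntegral.

(** * Gaussian integrals over column vectors, by Schur complements *)

Section GaussianIntegral.
Context {R : realType}.
Local Notation mu := (@lebesgue_measure R).

Lemma measurable_gauss1 (c t m : R) :
  measurable_fun [set: R] (fun x : R => c * expR (- (t / 2 * (x - m) ^+ 2))).
Proof.
apply: measurable_funM => //; apply: measurableT_comp => //.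
apply: measurable_funN; apply: measurable_funM => //.
by apply: measurable_funX; exact: measurable_funB.
Qed.

(** The integrand is a multiple of the normal density of mean [m] and variance [1 / t]. *)
Lemma integral_gauss1 (c t m : R) : 0 <= c -> 0 < t ->
  (\int[mu]_x (c * expR (- (t / 2 * (x - m) ^+ 2)))%:E)%E =
  (c * (2 * pi / t) `^ 2^-1)%:E.
Proof.
move=> c0 t0.
set s := Num.sqrt t^-1.
have s2 : s ^+ 2 = t^-1 by rewrite sqr_sqrtr// invr_ge0 ltW.
have sn0 : s != 0 by rewrite gt_eqF// sqrtr_gt0 invr_gt0.
have pk0 : 0 < normal_peak s := normal_peak_gt0 sn0.
have E x : (c * expR (- (t / 2 * (x - m) ^+ 2)))%:E =
   ((c / normal_peak s)%:E * (normal_pdf m s x)%:E)%E.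
  rewrite -EFinM normal_pdfE//.
  suff -> : - (t / 2 * (x - m) ^+ 2) = - (x - m) ^+ 2 / (s ^+ 2 *+ 2).
    by congr EFin; rewrite -/(normal_fun m s x) mulrA divfK// gt_eqF.
  rewrite s2.
  have tn0 : t != 0 by rewrite gt_eqF.
  by rewrite -mulr_natr; field.
under eq_integral do rewrite E.
rewrite ge0_integralZl//.
- rewrite integral_normal_pdf mule1 /normal_peak invrK; congr (_ * _)%:E.
  rewrite powR12_sqrt; last by rewrite divr_ge0 ?mulr_ge0 ?pi_ge0 ?ltW.
  by rewrite s2 -mulr_natr; congr Num.sqrt; ring.
- by apply/measurable_EFinP; exact: measurable_normal_pdf.
- by move=> x _; rewrite lee_fin normal_pdf_ge0.
- by rewrite lee_fin divr_ge0// ltW.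
Qed.

Definition qform {k : nat} (Q : 'M[R]_k) (v : 'cV[R]_k) : R := (v^T *m Q *m v) 0 0.

Definition posdef {k : nat} (Q : 'M[R]_k) : Prop :=
  Q^T = Q /\ forall v : 'cV[R]_k, v != 0 -> 0 < qform Q v.

(** A row of the left kernel of [Q] has quadratic form zero, so it vanishes. *)
Lemma posdef_unit k (Q : 'M[R]_k) : posdef Q -> Q \in unitmx.
Proof.
move=> [sQ pQ]; rewrite -row_free_unit -kermx_eq0; apply/eqP/row_matrixP => i.
rewrite row0; apply/eqP; apply: contraT => ni.
have := pQ (row i (kermx Q))^T; rewrite -trmx0 (inj_eq trmx_inj) => /(_ ni).
by rewrite /qform trmxK -row_mul mulmx_ker row0 mul0mx mxE ltxx.
Qed.

(** Completing the square in [v]. The coefficient left on [x ^+ 2] is the Schur complement of [Q] in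
    the block matrix. *)
Lemma qform_block k (q : R) (w : 'cV[R]_k) (Q : 'M[R]_k) (x : R) (v : 'cV[R]_k) :
  Q^T = Q -> Q \in unitmx ->
  let u := invmx Q *m w in
  qform (block_mx (q%:M : 'M[R]_1) w^T w Q) (col_mx (x%:M : 'M[R]_1) v) =
  qform Q (v + x *: u) + (q - (w^T *m u) 0 0) * x ^+ 2.
Proof.
move=> sQ uQ u; rewrite /qform.
have Qu : Q *m u = w by rewrite mulKVmx.
have uQ' : u^T *m Q = w^T by rewrite -{1}sQ -trmx_mul Qu.
have Eu : (v + x *: u)^T = v^T + x *: u^T by apply/matrixP => i j; rewrite !mxE.
have Evw : w^T *m v = v^T *m w.
  by apply/matrixP => i j; rewrite !mxE !ord1; apply: eq_bigr => l _; rewrite !mxE mulrC.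
rewrite tr_col_mx mul_row_block mul_row_col Eu tr_scalar_mx.
rewrite !mulmxDl !mulmxDr -!scalemxAl -!scalemxAr uQ' -(mulmxA v^T Q u) Qu Evw.
rewrite !mul_mx_scalar !mul_scalar_mx -!scalemxAl Evw.
rewrite ![in LHS]mxE ![in RHS]mxE /=.
by rewrite mulr1n; ring.
Qed.

Lemma posdef_block k (Q : 'M[R]_(1 + k)) : posdef Q ->
  let w := dlsubmx Q in let Q1 := drsubmx Q in let q := Q 0 0 in
  [/\ Q = block_mx (q%:M : 'M[R]_1) w^T w Q1, posdef Q1 &
      0 < q - (w^T *m (invmx Q1 *m w)) 0 0].
Proof.
move=> [sQ pQ] w Q1 q.
have EQ : Q = block_mx (q%:M : 'M[R]_1) w^T w Q1.
  rewrite -[LHS]submxK; congr block_mx.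
    rewrite [LHS]mx11_scalar; congr (_%:M); rewrite !mxE; congr (Q _ _); exact: val_inj.
  by rewrite /w trmx_dlsub sQ.
have sQ1 : Q1^T = Q1 by rewrite trmx_drsub sQ.
have pQ1 : posdef Q1.
  split=> // v v0; have := pQ (col_mx (0 : 'M[R]_1) v).
  rewrite [X in qform X]EQ /qform tr_col_mx mul_row_block mul_row_col trmx0 !mul0mx.
  rewrite mulmx0 !add0r; apply; apply: contra v0 => /eqP E0.
  by have [_ ->] := eq_col_mx (etrans E0 (esym (col_mx0 _ _ _ _))).
split=> //; set u := invmx Q1 *m w.
(* The Schur complement is the value of the form at the nonzero vector with blocks [1] and [- u]. *)
have := pQ (col_mx (1%:M : 'M[R]_1) (- u)).
rewrite [X in qform X]EQ qform_block// ?posdef_unit//.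
rewrite scale1r addNr expr1n mulr1 /qform mulmx0 mxE add0r; apply.
apply/eqP => /(congr1 (fun M : 'cV[R]_(1 + k) => M (lshift k 0) 0)).
by rewrite col_mxEu !mxE => /eqP; rewrite oner_eq0.
Qed.

(** Induction peels off one coordinate at a time, each leaving a one-dimensional Gaussian whose
    precision is [t] times a Schur complement. [D] is [(2 * pi) ^ (k / 2)] over the square root of
    the determinant of [Q]. It stays abstract because it cancels between the normalizer of the prior
    and the integral against the likelihood; its value at the identity serves to normalize
    [gauss_pdf]. *)
Lemma iint_gauss k (Q : 'M[R]_k) : posdef Q -> exists D : R,
  [/\ 0 < D, Q = 1%:M -> D = (2 * pi) `^ (k%:R / 2) &
   forall (c t : R) (m : 'cV[R]_k), 0 <= c -> 0 < t ->
   let f := fun v => (c * expR (- (t / 2 * qform Q (v - m))))%:E in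
   iint_nice f /\ iint f = (c * (D * t `^ (- (k%:R / 2))))%:E].
Proof.
elim: k Q => [|k IH] Q pQ.
  exists 1; split=> //; first by rewrite mul0r powRr0.
  move=> c t m c0 t0 f /=.
  have -> : f 0 = c%:E.
    by rewrite /f /qform (flatmx0 (0 - m)) mulmx0 mxE mulr0 oppr0 expR0 mulr1.
  by rewrite lee_fin c0 mul0r oppr0 powRr0 !mulr1.
have [] := posdef_block pQ; set w := dlsubmx _; set Q1 := drsubmx _.
set q := Q 0 0; set d := q - _ => EQ pQ1 d0.
have [D [D0 D1 HD]] := IH _ pQ1.
have pi20 : 0 < 2 * pi :> R by rewrite mulr_gt0 ?pi_gt0.
exists (D * (2 * pi / d) `^ 2^-1); split.
- by rewrite mulr_gt0// powR_gt0// divr_gt0.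
- move=> Q1E; have w0 : w = 0.
    by rewrite /w Q1E; apply/matrixP => i j; rewrite !mxE -val_eqE /= ord1.
  have -> : d = 1 by rewrite /d w0 trmx0 mul0mx mxE subr0 /q Q1E !mxE eqxx.
  rewrite D1; last first.
    by rewrite /Q1 Q1E; apply/matrixP => i j; rewrite !mxE -val_eqE /= eqSS.
  rewrite divr1 -powRD; last by apply/implyP => _; rewrite gt_eqF.
  by congr (_ `^ _); rewrite -(natr1 k) mulrDl mul1r.
move=> c t m c0 t0 f.
set u := invmx Q1 *m w.
pose m0 : R := (m : 'cV[R]_(1 + k)) 0 0; pose m1 := dsubmx (m : 'cV[R]_(1 + k)).
have Em : m = col_mx (m0%:M : 'M[R]_1) m1.
  apply: etrans (esym (vsubmxK (m : 'cV[R]_(1 + k)))) _; congr (col_mx _ _).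
  by rewrite [LHS]mx11_scalar; congr (_%:M); rewrite !mxE; congr (m _ _); exact: val_inj.
(* With the first coordinate frozen at [x], the centre of the others moves by a multiple of
   [x - m0], which does not change their integral. *)
have Ef x v : f (col_mx (x%:M : 'M[R]_1) v) =
   (c * expR (- (t * d / 2 * (x - m0) ^+ 2)) *
    expR (- (t / 2 * qform Q1 (v - (m1 - (x - m0) *: u)))))%:E.
  have Es : (col_mx (x%:M : 'M[R]_1) v : 'cV[R]_(1 + k)) - m =
      col_mx ((x - m0)%:M : 'M[R]_1) (v - m1).
    rewrite [X in _ - X = _]Em; apply: etrans (_ : _ = _ + col_mx (- m0%:M) (- m1)) _.
      by rewrite opp_col_mx.
    by rewrite add_col_mx -raddfB.
  rewrite /f [X in qform _ X]Es [X in qform X]EQ qform_block ?(posdef_unit pQ1)//; last by case: pQ1.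
  rewrite -/u -/d; congr EFin; rewrite -[RHS]mulrA -expRD; congr (_ * expR _).
  rewrite (_ : v - (m1 - (x - m0) *: u) = v - m1 + (x - m0) *: u); first by ring.
  by rewrite opprB addrCA addrC.
have nc x : 0 <= c * expR (- (t * d / 2 * (x - m0) ^+ 2)) by rewrite mulr_ge0 ?expR_ge0.
have Hx x := HD _ _ (m1 - (x - m0) *: u) (nc x) t0.
have Ei x : iint (fun v : 'cV[R]_k => f (col_mx (x%:M : 'M[R]_1) v)) =
   (c * (D * t `^ (- (k%:R / 2))) * expR (- (t * d / 2 * (x - m0) ^+ 2)))%:E.
  rewrite (eq_iint (Ef x)) (Hx x).2; congr EFin; ring.
split.
  split; first by move=> x; rewrite (funext (Ef x)); exact: (Hx x).1.
  by under eq_fun do rewrite Ei; apply/measurable_EFinP; exact: measurable_gauss1.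
rewrite /=; under eq_integral do rewrite Ei.
rewrite integral_gauss1; last 2 first.
- by rewrite mulr_ge0 ?mulr_ge0 ?powR_ge0 ?(ltW D0).
- by rewrite mulr_gt0.
congr EFin.
have -> : 2 * pi / (t * d) = 2 * pi / d * t^-1 by rewrite invfM; ring.
rewrite powRM; [|by rewrite divr_ge0 ?ltW|by rewrite invr_ge0 ltW].
rewrite -[t^-1]powR_inv1 ?ltW// -powRrM mulN1r.
have -> : - (k.+1%:R / 2) = - (k%:R / 2) + - 2^-1 :> R.
  by rewrite -(natr1 k) mulrDl mul1r opprD.
rewrite powRD; last by apply/implyP => _; rewrite gt_eqF.
ring.
Qed.

End GaussianIntegral.

(** * Markov and Chernoff bounds for Gaussian noise *)

Section GaussianTails.
Context {R : realType}.

Lemma sqnorm_ge0 n (v : 'cV[R]_n) : 0 <= sqnorm v.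
Proof. by apply: sumr_ge0 => i _; rewrite sqr_ge0. Qed.

Lemma sqnormE n (v : 'cV[R]_n) : sqnorm v = (v^T *m v) 0 0.
Proof. by rewrite mxE; apply: eq_bigr => i _; rewrite mxE. Qed.

Lemma sqnorm_eq0 n (v : 'cV[R]_n) : (sqnorm v == 0) = (v == 0).
Proof.
rewrite psumr_eq0; last by move=> i _; rewrite sqr_ge0.
apply/allP/eqP => [H|-> i _]; last by rewrite /= mxE expr0n eqxx.
apply/matrixP => i j; rewrite ord1 mxE; apply/eqP; rewrite -sqrf_eq0.
by have := H i (mem_index_enum i).
Qed.

Lemma posdef1 n : posdef (1%:M : 'M[R]_n).
Proof.
split=> [|v v0]; first by rewrite trmx1.
by rewrite /qform mulmx1 -sqnormE lt_def sqnorm_eq0 v0 sqnorm_ge0.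
Qed.

Lemma gauss_pdf_ge0 n (s2 : R) (e : 'cV[R]_n) : 0 <= gauss_pdf s2 e.
Proof. by rewrite mulr_ge0 ?powR_ge0 ?expR_ge0. Qed.

Lemma iint_gauss_pdf n (s2 c : R) (m : 'cV[R]_n) : 0 < s2 -> 0 <= c ->
  iint_nice (fun e => (c * gauss_pdf s2 (e - m))%:E) /\
  iint (fun e => (c * gauss_pdf s2 (e - m))%:E) = c%:E.
Proof.
move=> s0 c0; have [D [D0 D1 HD]] := iint_gauss (posdef1 n).
have pi20 : 0 < 2 * pi :> R by rewrite mulr_gt0 ?pi_gt0.
have s0' : 0 < s2^-1 by rewrite invr_gt0.
have c0' : 0 <= c * (2 * pi * s2) `^ (- (n%:R / 2)) by rewrite mulr_ge0 ?powR_ge0.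
have [H1 H2] := HD _ _ m c0' s0'.
have E (e : 'cV[R]_n) : (c * gauss_pdf s2 (e - m))%:E =
  (c * (2 * pi * s2) `^ (- (n%:R / 2)) * expR (- (s2^-1 / 2 * qform 1%:M (e - m))))%:E.
  rewrite /gauss_pdf /qform mulmx1 -sqnormE mulrA; congr (_ * expR (- _))%:E.
  by rewrite invfM; ring.
rewrite (funext E) H2; split=> //; congr EFin.
rewrite D1// -[s2^-1]powR_inv1 ?(ltW s0)// -powRrM mulN1r opprK.
rewrite -powRM ?(ltW s0) ?(ltW pi20)// -mulrA -powRD ?addNr ?powRr0 ?mulr1//.
by rewrite eqxx /= mulf_neq0 ?gt_eqF.
Qed.

(** Nonnegativity and [iint_nice] travel with the bound on the mean, so that bounds can be added and
    scaled without further measurability arguments. *)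
Definition gauss_mean_le (n : nat) (s2 : R) (h : 'cV[R]_n -> R) (eta : R) :=
  [/\ forall e, 0 <= h e,
      iint_nice (fun e => (gauss_pdf s2 e * h e)%:E) &
      (iint (fun e => (gauss_pdf s2 e * h e)%:E) <= eta%:E)%E].

Lemma gauss_mean_leD n (s2 : R) (h1 h2 : 'cV[R]_n -> R) eta1 eta2 :
  gauss_mean_le s2 h1 eta1 -> gauss_mean_le s2 h2 eta2 ->
  gauss_mean_le s2 (fun e => h1 e + h2 e) (eta1 + eta2).
Proof.
move=> [p1 n1 m1] [p2 n2 m2]; have [n3 E] := iint_niceD n1 n2.
have Ef : (fun e => (gauss_pdf s2 e * (h1 e + h2 e))%:E) =
  (fun e => (gauss_pdf s2 e * h1 e)%:E + (gauss_pdf s2 e * h2 e)%:E)%E.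
  by apply/funext => e; rewrite mulrDr EFinD.
split; first by move=> e; rewrite addr_ge0.
  by rewrite Ef.
by rewrite Ef E EFinD; exact: leeD.
Qed.

Lemma gauss_mean_leZ n (s2 c : R) (h : 'cV[R]_n -> R) eta : 0 <= c ->
  gauss_mean_le s2 h eta -> gauss_mean_le s2 (fun e => c * h e) (c * eta).
Proof.
move=> c0 [p1 n1 m1]; have [n3 E] := iint_niceZ c0 n1.
have Ef : (fun e => (gauss_pdf s2 e * (c * h e))%:E) =
  (fun e => c%:E * (gauss_pdf s2 e * h e)%:E)%E.
  by apply/funext => e; rewrite -EFinM mulrCA.
split; first by move=> e; rewrite mulr_ge0.
  by rewrite Ef.
by rewrite Ef E EFinM; exact: lee_wpmul2l.
Qed.

Lemma gauss_mean_le_sum n (s2 : R) (I : Type) (r : seq I)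
    (h : I -> 'cV[R]_n -> R) (eta : I -> R) :
  (forall i, gauss_mean_le s2 (h i) (eta i)) ->
  gauss_mean_le s2 (fun e => \sum_(i <- r) h i e) (\sum_(i <- r) eta i).
Proof.
move=> H; elim: r => [|i r IH].
  have [n0 E0] := @iint_nice0 R n.
  have Ef : (fun e => (gauss_pdf s2 e * \sum_(i <- [::]) h i e)%:E) =
    (fun _ : 'cV[R]_n => 0%E) by apply/funext => e; rewrite big_nil mulr0.
  by split; rewrite ?Ef ?E0 ?big_nil// => e; rewrite big_nil.
rewrite big_cons (_ : (fun _ => _) = (fun e => h i e + \sum_(i <- r) h i e)).
  exact: gauss_mean_leD.
by apply/funext => e; rewrite big_cons.
Qed.

(** The exponential factor only translates the density, to the centre [s2 *: w]; what comes out is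
    the Gaussian moment generating function. *)
Lemma gauss_mean_le_expR n (s2 : R) (w : 'cV[R]_n) : 0 < s2 ->
  gauss_mean_le s2 (fun e => expR ((w^T *m e) 0 0)) (expR (s2 * sqnorm w / 2)).
Proof.
move=> s0.
have Ef : (fun e => (gauss_pdf s2 e * expR ((w^T *m e) 0 0))%:E) =
  (fun e => (expR (s2 * sqnorm w / 2) * gauss_pdf s2 (e - s2 *: w))%:E).
  apply/funext => e; congr EFin; rewrite /gauss_pdf mulrCA -!mulrA -!expRD.
  congr (_ * expR _).
  have -> : sqnorm (e - s2 *: w) = sqnorm e - 2 * s2 * (w^T *m e) 0 0 + s2 ^+ 2 * sqnorm w.
    rewrite /sqnorm mxE !mulr_sumr -sumrB -big_split /=; apply: eq_bigr => i _.
    by rewrite !mxE; ring.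
  by have sn : s2 != 0; [rewrite gt_eqF|field].
have [H1 H2] := iint_gauss_pdf (s2 *: w) s0 (expR_ge0 (s2 * sqnorm w / 2)).
by split; [move=> e; exact: expR_ge0|rewrite Ef|rewrite Ef H2].
Qed.

(** For [y >= 0], squaring [1 + y / 2 <= expR (y / 2)] gives [y ^+ 2 <= 4 * expR y]; the second
    exponential covers negative [z]. *)
Lemma sqr_le_expR (z : R) : z ^+ 2 <= 4 * (expR z + expR (- z)).
Proof.
have H (y : R) : 0 <= y -> y ^+ 2 <= 4 * expR y.
  move=> y0; have := expR_ge1Dx (y / 2) => h.
  have -> : expR y = expR (y / 2) ^+ 2 by rewrite -expRM_natl; congr expR; field.
  by nra.
have [z0|/ltW z0] := leP 0 z.
  by apply: le_trans (H _ z0) _; rewrite ler_wpM2l// lerDl expR_ge0.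
rewrite -sqrrN; apply: le_trans (H _ _) _; first by rewrite oppr_ge0.
by rewrite ler_wpM2l// lerDr expR_ge0.
Qed.

Lemma expR_half_le2 : expR 2^-1 <= 2 :> R.
Proof.
have := expR_ge1Dx (- 2^-1 : R); rewrite expRN => h.
rewrite -[expR 2^-1]invrK -[leRHS]invrK lef_pV2 ?posrE ?invr_gt0 ?expR_gt0//.
by apply: le_trans h; lra.
Qed.

(* The events of interest are not known to be measurable, so a bound on their
   probability always goes through a dominating function [h]. *)
Definition gauss_tail (n : nat) (s2 : R) (Z : 'cV[R]_n -> Prop) (eta : R) :=
  exists h, gauss_mean_le s2 h eta /\ forall e, Z e -> 1 <= h e.

(** Markov's inequality: [h] dominates the indicator of the event. *)
Lemma gauss_prob_tail n (s2 : R) (Z : 'cV[R]_n -> bool) eta :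
  gauss_tail s2 (fun e => Z e) eta -> (0 <= gauss_prob s2 Z <= eta%:E)%E.
Proof.
move=> [h [[h0 _ hm] hZ]]; apply/andP; split.
  by apply: iint_ge0 => e; rewrite lee_fin mulr_ge0 ?gauss_pdf_ge0.
apply: le_trans hm; apply: le_iint => e; rewrite lee_fin.
  by rewrite mulr_ge0 ?gauss_pdf_ge0.
rewrite ler_wpM2l ?gauss_pdf_ge0//.
by case E: (Z e); rewrite //= hZ.
Qed.

Lemma gauss_tailS n (s2 : R) (Z Z' : 'cV[R]_n -> Prop) eta eta' :
  (forall e, Z e -> Z' e) -> eta' <= eta ->
  gauss_tail s2 Z' eta' -> gauss_tail s2 Z eta.
Proof.
move=> ZZ le [h [[h0 hn hm] hZ]]; exists h; split; last by move=> e /ZZ /hZ.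
by split=> //; apply: le_trans hm _; rewrite lee_fin.
Qed.

Lemma gauss_tailU n (s2 : R) (Z Z' : 'cV[R]_n -> Prop) eta eta' :
  gauss_tail s2 Z eta -> gauss_tail s2 Z' eta' ->
  gauss_tail s2 (fun e => Z e \/ Z' e) (eta + eta').
Proof.
move=> [h [hm hZ]] [h' [hm' hZ']]; exists (fun e => h e + h' e).
split; first exact: gauss_mean_leD.
have [h0 _ _] := hm; have [h0' _ _] := hm'.
move=> e [/hZ H|/hZ' H]; first by rewrite -[1]addr0 lerD.
by rewrite -[1]add0r lerD.
Qed.

Lemma gauss_tail_exists n (s2 : R) (I : finType) (Z : I -> 'cV[R]_n -> Prop)
    (eta : I -> R) :
  (forall i, gauss_tail s2 (Z i) (eta i)) ->
  gauss_tail s2 (fun e => exists i, Z i e) (\sum_i eta i).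
Proof.
move=> /choice[h hH].
exists (fun e => \sum_i h i e); split.
  by apply: gauss_mean_le_sum => i; have [] := hH i.
move=> e [i Zi]; rewrite (bigD1 i)//=.
have [_ h1] := hH i; rewrite -[1]addr0 lerD ?h1// sumr_ge0// => j _.
by have [[h0 _ _] _] := hH j; exact: h0.
Qed.

(** The scale [l] gives the linear form unit variance, so both exponential moments equal
    [expR 2^-1 <= 2]. The constant 16 is [4 * (2 + 2)]. *)
Lemma gauss_mean_le_linear n (s2 : R) (w : 'cV[R]_n) : 0 < s2 ->
  exists h, gauss_mean_le s2 h (16 * (s2 * sqnorm w)) /\
    forall e, ((w^T *m e) 0 0) ^+ 2 <= h e.
Proof.
move=> s0; set q := s2 * sqnorm w; have q0 : 0 <= q by rewrite mulr_ge0 ?sqnorm_ge0 ?ltW.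
pose l := (Num.sqrt q)^-1.
exists (fun e => q * 4 * (expR (((l *: w)^T *m e) 0 0) + expR (((- l *: w)^T *m e) 0 0))).
have [w0|wn0] := eqVneq q 0.
  have {}w0 : w = 0.
    by apply/eqP; move/eqP: w0; rewrite mulf_eq0 gt_eqF//= sqnorm_eq0.
  have -> : q = 0 by apply/eqP; rewrite mulf_eq0 sqnorm_eq0 w0 eqxx orbT.
  split; last by move=> e; rewrite w0 trmx0 mul0mx mxE expr0n !mul0r.
  (* When [q = 0] the dominating function is zero, and the empty sum supplies its mean bound. *)
  have := gauss_mean_le_sum [::] (fun i : 'I_0 => gauss_mean_le_expR (0 : 'cV[R]_n) s0).
  rewrite big_nil mulr0; under eq_fun do rewrite big_nil.
  by under [X in _ -> gauss_mean_le _ X _]eq_fun do rewrite !mul0r.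
have qp : 0 < q by rewrite lt_def wn0.
have l2 : l ^+ 2 * q = 1 by rewrite exprVn sqr_sqrtr// mulVf.
have sl (c : R) : c ^+ 2 = l ^+ 2 -> s2 * sqnorm (c *: w) / 2 = 2^-1.
  move=> cl; have -> : sqnorm (c *: w) = c ^+ 2 * sqnorm w.
    by rewrite /sqnorm mulr_sumr; apply: eq_bigr => i _; rewrite mxE exprMn.
  by rewrite mulrCA -/q cl l2 mul1r.
split.
  have -> : 16 * q = q * 4 * (2 + 2) by ring.
  apply: gauss_mean_leZ; first by rewrite mulr_ge0.
  apply: gauss_mean_leD.
    have [a1 a2 a3] := gauss_mean_le_expR (l *: w) s0; split=> //.
    by apply: le_trans a3 _; rewrite sl// lee_fin expR_half_le2.
  have [a1 a2 a3] := gauss_mean_le_expR (- l *: w) s0; split=> //.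
  by apply: le_trans a3 _; rewrite sl ?sqrrN// lee_fin expR_half_le2.
move=> e; set z := (w^T *m e) 0 0.
have E (c : R) : ((c *: w)^T *m e) 0 0 = c * z.
  by rewrite linearZ /= -scalemxAl mxE.
rewrite !E mulNr -mulrA; have := sqr_le_expR (l * z).
rewrite -(ler_pM2l qp) => H; apply: le_trans H.
by rewrite exprMn mulrA (mulrC q) l2 mul1r.
Qed.

(** Markov's inequality, with the squared norm split into the squares of the linear forms given by
    the rows of [W]. The double sum is the squared Frobenius norm, which is small for a projection
    of small rank. *)
Lemma gauss_tail_quad m n (s2 M : R) (W : 'M[R]_(m, n)) : 0 < s2 -> 0 < M ->
  gauss_tail s2 (fun e => M <= sqnorm (W *m e))
    (16 * s2 * (\sum_i \sum_j (W i j) ^+ 2) / M).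
Proof.
move=> s0 M0.
have /choice[h hH] i := gauss_mean_le_linear (row i W)^T s0.
exists (fun e => M^-1 * \sum_i h i e); split.
  rewrite [X in gauss_mean_le _ _ X]mulrC.
  apply: gauss_mean_leZ; first by rewrite invr_ge0 ltW.
  rewrite mulr_sumr; apply: gauss_mean_le_sum => i.
  have [+ _] := hH i; rewrite mulrA (_ : sqnorm _ = \sum_j W i j ^+ 2)//.
  by apply: eq_bigr => j _; rewrite !mxE.
move=> e He; rewrite mulrC ler_pdivlMr// mul1r; apply: le_trans He _.
rewrite /sqnorm; apply: ler_sum => i _; have [_ /(_ e)] := hH i.
by rewrite trmxK -row_mul mxE.
Qed.

(** A Chernoff bound: tilting by [expR (- (sqnorm e / (2 * s2)))] halves the variance, so the mean
    of the dominating function is [expR (n / 8) * 2 ^ (- n / 2)], and [expR 2^-1 <= 2] bounds it. *)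
Lemma gauss_tail_small n (s2 : R) : 0 < s2 ->
  gauss_tail s2 (fun e : 'cV[R]_n => sqnorm e < n%:R * s2 / 4) (expR (- (n%:R / 8))).
Proof.
move=> s0; have sn : s2 != 0 by rewrite gt_eqF.
exists (fun e => expR ((n%:R * s2 / 4 - sqnorm e) / (2 * s2))); split; last first.
  move=> e He; rewrite -[leLHS]expR0 ler_expR; apply: divr_ge0; first by rewrite subr_ge0 ltW.
  by apply: mulr_ge0 => //; exact: ltW.
pose c : R := expR (n%:R / 8) * 2 `^ (- (n%:R / 2)).
have c0 : 0 <= c by rewrite mulr_ge0 ?expR_ge0 ?powR_ge0.
have s20 : 0 < s2 / 2 by rewrite divr_gt0.
have pi20 : 0 < 2 * pi :> R by rewrite mulr_gt0 ?pi_gt0.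
have [H1 H2] := iint_gauss_pdf (0 : 'cV[R]_n) s20 c0.
have Ef : (fun e => (gauss_pdf s2 e * expR ((n%:R * s2 / 4 - sqnorm e) / (2 * s2)))%:E) =
   (fun e : 'cV[R]_n => (c * gauss_pdf (s2 / 2) (e - 0))%:E).
  apply/funext => e; congr EFin; rewrite subr0 /gauss_pdf /c.
  have -> : 2 * pi * s2 = 2 * (2 * pi * (s2 / 2)) by field.
  rewrite [in LHS]powRM//; last by rewrite mulr_ge0 ?ltW.
  rewrite -[LHS]mulrA -expRD.
  rewrite (_ : _ + _ = n%:R / 8 + - (sqnorm e / (2 * (s2 / 2)))); last by field.
  rewrite expRD; set u := _ `^ _; set v := _ `^ _; set x := expR _; set y := expR _.
  by ring.
split; first by move=> e; exact: expR_ge0.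
  by rewrite Ef.
rewrite Ef H2 lee_fin /c powRN.
have H : expR (n%:R / 4) <= 2 `^ (n%:R / 2) :> R.
  have -> : n%:R / 4 = 2^-1 * (n%:R / 2) :> R by field.
  by rewrite expRM ge0_ler_powR ?nnegrE ?expR_ge0 ?expR_half_le2.
rewrite ler_pdivrMr ?powR_gt0//.
apply: le_trans (ler_wpM2l (expR_ge0 _) H).
by rewrite -expRD ler_expR; lra.
Qed.

End GaussianTails.

(** * Scaling of Lebesgue measure and inverse-gamma integrals *)

Section InverseGamma.
Context {R : realType}.
Local Notation mu := (@lebesgue_measure R).

(** By uniqueness of Lebesgue measure, it suffices to compare the two sides on half-open
    intervals. *)
Lemma lebesgue_measure_scale (c : R) (A : set R) : 0 < c -> measurable A ->
  mu A = (c%:E * pushforward mu (( *%R c) : R -> measurableTypeR R) A)%E.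
Proof.
move=> c0 mA; pose k := NngNum (ltW c0).
have mphi : measurable_fun [set: R] (( *%R c) : R -> measurableTypeR R).
  exact: mulrl_measurable.
unshelve refine (@lebesgue_measure_unique R
  (mscale k (pushforward mu (( *%R c) : R -> measurableTypeR R))) _ A mA) => //.
move=> _ [[a b]] _ <-.
change (mu `]a, b]%classic = (c%:E * mu ((fun x : R => c * x)%R @^-1` `]a, b]%classic))%E).
rewrite (_ : _ @^-1` _ = `](a / c), (b / c)]%classic); last first.
  by apply/seteqP; split=> x /=; rewrite !in_itv /= ltr_pdivrMr// ler_pdivlMr// mulrC.
rewrite !lebesgue_measure_itv/= !lte_fin ltr_pM2r ?invr_gt0//.
case: ifP => _; last by rewrite mule0.
by rewrite -!EFinB -EFinM -mulrBl mulrC divfK ?gt_eqF.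
Qed.

Lemma ge0_integral_scale (c : R) (f : R -> \bar R) : 0 < c ->
  measurable_fun [set: R] f -> (forall x, 0 <= f x)%E ->
  (\int[mu]_x f x = c%:E * \int[mu]_x f (c * x)%R)%E.
Proof.
move=> c0 mf f0; pose k := NngNum (ltW c0).
have -> : (\int[mu]_x f (c * x)%R =
    \int[pushforward mu (( *%R c) : _ -> measurableTypeR R)]_x f x)%E.
  by rewrite ge0_integral_pushforward.
unshelve rewrite -(@ge0_integral_mscale _ _ R
  (pushforward mu (( *%R c) : R -> measurableTypeR R)) _ measurableT k f)//.
by apply: eq_measure_integral => A mA _; exact: lebesgue_measure_scale.
Qed.

Lemma posRE : @posR R = `]0, +oo[%classic.
Proof. by apply/seteqP; split=> x /=; rewrite in_itv/= andbT. Qed.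

Lemma measurable_posR : measurable (@posR R : set (measurableTypeR R)).
Proof. by rewrite posRE; exact: measurable_itv. Qed.

Lemma ge0_integral_posR_lower (f : R -> R) (c u : R) : 0 <= c -> 0 < u ->
  measurable_fun (@posR R) f -> (forall x, 0 < x -> 0 <= f x) ->
  (forall x, u <= x <= u + 1 -> c <= f x) ->
  (c%:E <= \int[mu]_(x in posR) (f x)%:E)%E.
Proof.
move=> c0 u0 mf f0 fc.
pose I := `[u, u + 1]%classic.
have mI : measurable I by exact: measurable_itv.
have sub : I `<=` @posR R.
  by move=> x; rewrite /I /= in_itv/= => /andP[ux _]; exact: lt_le_trans ux.
have mf' : measurable_fun (@posR R) (EFin \o f) by exact/measurable_EFinP.
suff H : (c%:E <= \int[mu]_(x in I) (f x)%:E)%E.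
  apply: le_trans H _; apply: ge0_subset_integral => //=.
  exact: measurable_posR.
rewrite -[c%:E]mule1 -(_ : mu I = 1%E); last first.
  rewrite lebesgue_measure_itv/= lte_fin ltrDl ltr01 -EFinB; congr EFin; ring.
rewrite -integral_cst//; apply: ge0_le_integral => //.
  exact: (measurable_funS measurable_posR sub mf').
Qed.

Lemma ig_kernel_ge0 (al be x : R) : 0 <= ig_kernel al be x.
Proof. by rewrite /ig_kernel; case: ifP => _ //; rewrite mulr_ge0 ?powR_ge0 ?expR_ge0. Qed.

Lemma measurable_ig_kernel (al be : R) : measurable_fun [set: R] (ig_kernel al be).
Proof.
have -> : ig_kernel al be =
    fun x => if 0 < x then x `^ (- al - 1) * expR (- (be * x `^ (-1))) else 0.
  by apply/funext => x; rewrite /ig_kernel; case: ifPn => // x0; rewrite powR_inv1// ltW.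
apply: measurable_fun_ifT => //=; first exact: measurable_fun_ltr.
apply: measurable_funM; first exact: measurable_powR.
apply: measurableT_comp => //; apply: measurable_funN.
by apply: measurable_funM => //; exact: measurable_powR.
Qed.

Lemma integral_ig_kernelT (al be : R) :
  (\int[mu]_(x in posR) (ig_kernel al be x)%:E = \int[mu]_x (ig_kernel al be x)%:E)%E.
Proof.
rewrite integral_mkcond; apply: eq_integral => x _; rewrite patchE.
by case: ifPn => //; rewrite notin_setE /posR /= => /negP /negbTE xp; rewrite /ig_kernel xp.
Qed.

(** Comes from [ln u <= u] at [u = be / (c * x)]. It controls the kernel near 0, where the power
    alone blows up. *)
Lemma ig_kernel_le (al be x : R) : 0 < be -> 0 < al -> 0 < x ->
  ig_kernel al be x <= ((al + 1) / be) `^ (al + 1).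
Proof.
move=> be0 al0 x0; rewrite /ig_kernel x0; set c := al + 1.
have c0 : 0 < c by rewrite addr_gt0.
have -> : x `^ (- al - 1) = expR (c * ln x^-1).
  by rewrite /powR gt_eqF// lnV ?posrE// /c; congr expR; ring.
have -> : (c / be) `^ c = expR (c * ln (c / be)) by rewrite /powR gt_eqF// divr_gt0.
rewrite -expRD ler_expR.
have h : ln (be / (c * x)) <= be / (c * x).
  by apply/ltW/ln_sublinear; rewrite divr_gt0// mulr_gt0.
have -> : ln x^-1 = ln (be / (c * x)) + ln (c / be).
  rewrite -lnM ?posrE ?divr_gt0 ?mulr_gt0//; congr ln.
  by have cn : c != 0; [rewrite gt_eqF|field; rewrite !gt_eqF].
rewrite mulrDr -addrA [X in _ + X]addrC addrA gerDr subr_le0.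
apply: le_trans (ler_wpM2l (ltW c0) h) _.
by rewrite le_eqVlt; apply/orP; left; apply/eqP; field; rewrite !gt_eqF.
Qed.

Lemma powRN_cvgy (al : R) : 0 < al -> x `^ (- al) @[x --> +oo] --> (0 : R).
Proof.
move=> al0; apply/cvgrPdist_lt => e e0.
near=> x.
have x0 : 0 < x by near: x; exact: nbhs_pinfty_gt.
rewrite sub0r normrN ger0_norm ?powR_ge0//.
have : e `^ (- al^-1) < x by near: x; exact: nbhs_pinfty_gt.
move=> /(gt0_ltr_powR al0); rewrite !nnegrE powR_ge0 (ltW x0) => /(_ isT isT).
rewrite -powRrM mulNr mulVf ?gt_eqF// powR_inv1 ?(ltW e0)// => H.
by rewrite powRN -[e]invrK ltf_pV2 ?posrE ?powR_gt0 ?invr_gt0.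
Unshelve. all: by end_near. Qed.

Lemma integral_powR_tail (al : R) : 0 < al ->
  (\int[mu]_(x in `[1%R, +oo[) (x `^ (- al - 1))%:E = al^-1%:E)%E.
Proof.
move=> al0.
have alN : al != 0 by rewrite gt_eqF.
have dp (x r : R) : 0 < x -> derivable (fun x : R => x `^ r) x 1.
  by move=> x0; apply: derivable_powR; rewrite in_itv/= andbT.
have cp (x r : R) : 0 < x -> {for x, continuous (fun x : R => x `^ r)}.
  by move=> x0; apply: differentiable_continuous; apply/derivable1_diffP; exact: dp.
rewrite (@ge0_continuous_FTC2y R _ (fun x => - al^-1 * x `^ (- al)) 1 0).
- by rewrite powR1 mulr1 -EFinB sub0r opprK.
- by move=> x _; exact: powR_ge0.
- apply: continuous_in_subspaceT => x; rewrite inE/= in_itv/= andbT => x1.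
  by apply: cp; exact: lt_le_trans x1.
- rewrite -[X in _ --> X](mulr0 (- al^-1)); apply: cvgM; first exact: cvg_cst.
  exact: powRN_cvgy.
- move=> x x1; apply: derivableM => //; apply: dp; exact: lt_trans x1.
- apply: cvg_at_right_filter; apply: cvgM; first exact: cvg_cst.
  exact: cp.
- move=> x; rewrite in_itv/= andbT => x1.
  have x0 : 0 < x := lt_trans ltr01 x1.
  rewrite derive1E deriveM//; last exact: dp.
  rewrite derive_cst scaler0 addr0 -derive1E powR_derive1 ?in_itv/= ?andbT//.
  by rewrite scalerA mulrNN mulVf// scale1r.
Qed.

(** Below 1 the kernel is bounded by a constant; above 1 the exponential is at most 1 and an
    integrable power remains. *)
Lemma integral_ig_kernel_fin (al be : R) : 0 < al -> 0 < be ->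
  (\int[mu]_(x in posR) (ig_kernel al be x)%:E < +oo)%E.
Proof.
move=> al0 be0.
have mk D : measurable_fun D (EFin \o ig_kernel al be).
  by apply/measurable_EFinP; exact: measurable_funTS (measurable_ig_kernel al be).
have EU : @posR R = (`]0, 1[ `|` `[1, +oo[)%classic.
  rewrite posRE -itv_bndbnd_setU ?bnd_simp//.
rewrite EU ge0_integral_setU//=; last 3 first.
  exact: mk.
  by move=> x _; rewrite lee_fin ig_kernel_ge0.
  apply/disj_setPS => x /=; rewrite !in_itv/= andbT => -[/andP[_ x1]].
  by rewrite leNgt x1.
apply: lte_add_pinfty.
  apply: (@le_lt_trans _ _ (\int[mu]_(x in `]0%R, 1%R[) ((((al + 1) / be) `^ (al + 1))%:E))%E).
    apply: ge0_le_integral => //=.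
      by move=> x _; rewrite lee_fin ig_kernel_ge0.
      exact: mk.
    by move=> x; rewrite in_itv/= => /andP[x0 _]; rewrite lee_fin ig_kernel_le.
  by rewrite integral_cst//= lebesgue_measure_itv/= lte_fin ltr01 -EFinB -EFinM ltry.
apply: (@le_lt_trans _ _ (\int[mu]_(x in `[1%R, +oo[) (x `^ (- al - 1))%:E)%E).
  apply: ge0_le_integral => //=.
  - by move=> x _; rewrite lee_fin ig_kernel_ge0.
  - exact: mk.
  - by apply/measurable_EFinP; exact: measurable_funTS (measurable_powR _).
  move=> x; rewrite in_itv/= andbT => x1; rewrite lee_fin /ig_kernel (lt_le_trans ltr01 x1).
  rewrite ler_piMr ?powR_ge0// expR_le1 oppr_le0 divr_ge0 ?ltW//.
  exact: lt_le_trans x1.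
by rewrite integral_powR_tail// ltry.
Qed.

(** This is the Gamma function at [al], in the variable [1 / x]. *)
Definition ig_mass (al : R) : R := fine (\int[mu]_(x in posR) (ig_kernel al 1 x)%:E)%E.

Lemma ig_mass_gt0 (al : R) : 0 < al -> 0 < ig_mass al.
Proof.
move=> al0; apply: fine_gt0; rewrite integral_ig_kernel_fin// andbT.
set c := 2 `^ (- al - 1) * expR (- 1) : R.
have c0 : 0 < c by rewrite mulr_gt0 ?powR_gt0 ?expR_gt0.
apply: (@lt_le_trans _ _ c%:E); first by rewrite lte_fin.
apply: (@ge0_integral_posR_lower _ _ 1) => //; first exact: ltW.
- exact: measurable_funTS (measurable_ig_kernel _ _).
- by move=> x _; exact: ig_kernel_ge0.
move=> x /andP[x1 x2]; have x0 : 0 < x := lt_le_trans ltr01 x1.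
rewrite /ig_kernel x0 /c ler_pM ?powR_ge0 ?expR_ge0//.
  rewrite -[- al - 1]opprD !powRN lef_pV2 ?posrE ?powR_gt0//.
  by rewrite ge0_ler_powR ?nnegrE ?(ltW x0) ?addr_ge0 ?(ltW al0).
by rewrite ler_expR lerN2 div1r invf_le1.
Qed.

Lemma integral_ig_kernel (al be : R) : 0 < al -> 0 < be ->
  (\int[mu]_(x in posR) (ig_kernel al be x)%:E = (be `^ (- al) * ig_mass al)%:E)%E.
Proof.
move=> al0 be0; rewrite integral_ig_kernelT (@ge0_integral_scale be)//.
- have E x : (ig_kernel al be (be * x))%:E = ((be `^ (- al - 1))%:E * (ig_kernel al 1 x)%:E)%E.
    rewrite -EFinM; congr EFin; rewrite /ig_kernel pmulr_rgt0//.
    case: ifPn => x0; last by rewrite mulr0.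
    rewrite powRM ?(ltW x0) ?(ltW be0)// mulrA; congr (_ * expR (- _)).
    by rewrite invfM mulrA divff ?gt_eqF.
  under eq_integral do rewrite E.
  rewrite ge0_integralZl//.
  + rewrite -integral_ig_kernelT /ig_mass EFinM fineK; last first.
      rewrite ge0_fin_numE ?integral_ig_kernel_fin//.
      by apply: integral_ge0 => x _; rewrite lee_fin ig_kernel_ge0.
    rewrite muleA -EFinM; congr (_%:E * _)%E.
    rewrite -{1}(@powRr1 R be) ?(ltW be0)// -powRD; last by apply/implyP => _; rewrite gt_eqF.
    by congr (_ `^ _); ring.
  + by apply/measurable_EFinP; exact: measurable_ig_kernel.
  + by move=> x _; rewrite lee_fin ig_kernel_ge0.
  + by rewrite lee_fin powR_ge0.
- by apply/measurable_EFinP; exact: measurable_ig_kernel.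
- by move=> x; rewrite lee_fin ig_kernel_ge0.
Qed.

End InverseGamma.

(** * Orthogonal projections and residual sums of squares *)

Section Projections.
Context {R : realType}.

Definition proj_mx_onto {n k : nat} (U : 'M[R]_(n, k)) : 'M[R]_n :=
  U *m invmx (U^T *m U) *m U^T.

Definition mx_injective {n k : nat} (U : 'M[R]_(n, k)) : Prop :=
  forall c : 'cV[R]_k, U *m c = 0 -> c = 0.

(** Residual sum of squares in Pythagorean form; for injective [U] it is the squared norm of the
    residual. *)
Definition rss {n k : nat} (U : 'M[R]_(n, k)) (y : 'cV[R]_n) : R :=
  sqnorm y - sqnorm (proj_mx_onto U *m y).

Lemma qform_gram n k (U : 'M[R]_(n, k)) c : qform (U^T *m U) c = sqnorm (U *m c).
Proof. by rewrite sqnormE trmx_mul /qform !mulmxA. Qed.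

Lemma gram_posdef n k (U : 'M[R]_(n, k)) : mx_injective U -> posdef (U^T *m U).
Proof.
move=> iU; split=> [|v v0]; first by rewrite trmx_mul trmxK.
rewrite qform_gram lt_def sqnorm_ge0 sqnorm_eq0 andbT.
by apply: contra v0 => /eqP/iU ->.
Qed.

Lemma sqnorm_sym_idem n (P : 'M[R]_n) (e : 'cV[R]_n) : P^T = P -> P *m P = P ->
  sqnorm (P *m e) = (e^T *m P *m e) 0 0.
Proof. by move=> sP iP; rewrite sqnormE trmx_mul sP mulmxA -(mulmxA e^T P P) iP. Qed.

Section OneDesign.
Variables (n k : nat) (U : 'M[R]_(n, k)).
Hypothesis iU : mx_injective U.
Local Notation P := (proj_mx_onto U).
Local Notation G := (U^T *m U).

Lemma gram_unit : G \in unitmx.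
Proof. exact: posdef_unit (gram_posdef iU). Qed.

Lemma proj_mx_onto_id : P *m U = U.
Proof. by rewrite /proj_mx_onto -!mulmxA mulVmx ?gram_unit// mulmx1. Qed.

Lemma proj_mx_onto_sym : P^T = P.
Proof.
by rewrite /proj_mx_onto !trmx_mul trmxK trmx_inv trmx_mul trmxK mulmxA.
Qed.

Lemma proj_mx_onto_idem : P *m P = P.
Proof. by rewrite {2 3}/proj_mx_onto !mulmxA proj_mx_onto_id. Qed.

Lemma sqnorm_proj (e : 'cV[R]_n) : sqnorm (P *m e) = (e^T *m P *m e) 0 0.
Proof. exact: sqnorm_sym_idem proj_mx_onto_sym proj_mx_onto_idem. Qed.

(** For a symmetric idempotent matrix the squared Frobenius norm is the trace, and cyclicity turns
    that trace into the one of the identity of size [k]. *)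
Lemma frobenius_proj : \sum_i \sum_j (P i j) ^+ 2 = k%:R.
Proof.
have -> : \sum_i \sum_j (P i j) ^+ 2 = \tr (P *m P^T).
  rewrite /mxtrace; apply: eq_bigr => i _; rewrite mxE; apply: eq_bigr => j _.
  by rewrite [P^T _ _]mxE.
rewrite proj_mx_onto_sym proj_mx_onto_idem /proj_mx_onto -mulmxA mxtrace_mulC.
by rewrite -mulmxA mulVmx ?gram_unit// mxtrace1.
Qed.

Lemma rssE (y : 'cV[R]_n) : rss U y = (y^T *m (1%:M - P) *m y) 0 0.
Proof.
have mxB (M N : 'M[R]_1) : (M - N) 0 0 = M 0 0 - N 0 0 by rewrite !mxE.
by rewrite mulmxBr mulmxBl mulmx1 mxB -sqnormE -sqnorm_proj.
Qed.

Lemma rss_sqnorm (y : 'cV[R]_n) : rss U y = sqnorm ((1%:M - P) *m y).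
Proof.
rewrite rssE -sqnorm_sym_idem//.
  by rewrite linearB /= trmx1 proj_mx_onto_sym.
by rewrite mulmxBl mul1mx mulmxBr mulmx1 proj_mx_onto_idem subrr subr0.
Qed.

Lemma rss_ge0 (y : 'cV[R]_n) : 0 <= rss U y.
Proof. by rewrite rss_sqnorm sqnorm_ge0. Qed.

Lemma rss_le (y : 'cV[R]_n) : rss U y <= sqnorm y.
Proof. by rewrite /rss gerBl sqnorm_ge0. Qed.

(** The exponents of likelihood and g-prior combine into one quadratic, centred at the least-squares
    estimate shrunk by [g / (1 + g)]. *)
Lemma complete_square (g s2 : R) (y : 'cV[R]_n) (c : 'cV[R]_k) : 0 < g -> 0 < s2 ->
  sqnorm (y - U *m c) / s2 + (g * s2)^-1 * qform G c =
  (1 + g) / (g * s2) * qform G (c - (g / (1 + g)) *: (invmx G *m U^T *m y)) +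
  (rss U y + (sqnorm y - rss U y) / (1 + g)) / s2.
Proof.
move=> g0 s0; set h := invmx G *m U^T *m y; set tau := g / (1 + g).
have Uh : U *m h = P *m y by rewrite /h !mulmxA.
set bt := (y^T *m (U *m c)) 0 0.
have Ebt : ((P *m y)^T *m (U *m c)) 0 0 = bt.
  by rewrite trmx_mul proj_mx_onto_sym -(mulmxA y^T P (U *m c)) (mulmxA P U c) proj_mx_onto_id.
have sqB (u v : 'cV[R]_n) (r : R) :
    sqnorm (u - r *: v) = sqnorm u - 2 * r * (v^T *m u) 0 0 + r ^+ 2 * sqnorm v.
  rewrite /sqnorm mxE !mulr_sumr -sumrB -big_split /=; apply: eq_bigr => i _.
  by rewrite !mxE; ring.
rewrite !qform_gram mulmxBr -scalemxAr Uh sqB Ebt.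
have -> : sqnorm (y - U *m c) = sqnorm y - 2 * bt + sqnorm (U *m c).
  rewrite -[U *m c in LHS]scale1r sqB expr1n mul1r mulr1; congr (_ - _ * _ + _).
  by rewrite /bt !mxE; apply: eq_bigr => i _; rewrite !mxE mulrC.
rewrite /rss /tau.
have g1 : 1 + g != 0 by rewrite gt_eqF// addr_gt0.
by field; rewrite g1 !gt_eqF.
Qed.

End OneDesign.

End Projections.

(** * Submatrices of selected columns *)

Section Subcols.
Context {R : realType}.

Lemma subcolsE n p (X : 'M[R]_(n, p)) (S : {set 'I_p}) :
  subcols X S = X *m \matrix_(i < p, j < #|S|) (i == enum_val j)%:R.
Proof.
apply/matrixP => i j; rewrite !mxE (bigD1 (enum_val j))//= mxE eqxx mulr1.
by rewrite big1 ?addr0// => l /negbTE lj; rewrite mxE lj mulr0.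
Qed.

Lemma subcols_injective n p (X : 'M[R]_(n, p)) (S : {set 'I_p}) :
  \rank X = p -> mx_injective (subcols X S).
Proof.
move=> rX c; rewrite subcolsE -mulmxA.
set E := \matrix_(i, j) _ => H.
have Ec : E *m c = 0.
  apply: trmx_inj; rewrite trmx0; apply: (@row_free_inj _ _ _ _ X^T).
    by rewrite /row_free mxrank_tr rX.
  by rewrite -trmx_mul H trmx0 mul0mx.
apply/matrixP => j l; rewrite ord1 {l} mxE.
have /matrixP/(_ (enum_val j) 0) := Ec; rewrite !mxE (bigD1 j)//= mxE eqxx mul1r.
rewrite big1 ?addr0// => l lj; rewrite mxE (_ : _ == _ = false) ?mul0r//.
by apply/eqP => /enum_val_inj jl; rewrite jl eqxx in lj.
Qed.

Lemma subcols_sub n p (X : 'M[R]_(n, p)) (A B : {set 'I_p}) : A \subset B ->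
  exists C : 'M[R]_(#|B|, #|A|), subcols X A = subcols X B *m C.
Proof.
move=> AB; exists (\matrix_(i, j) (enum_val i == enum_val j)%:R).
apply/matrixP => i j; rewrite !mxE.
have jB : enum_val j \in B by apply: (fintype.subsetP AB); exact: enum_valP.
rewrite (bigD1 (enum_rank_in jB (enum_val j)))//= !mxE enum_rankK_in// eqxx mulr1.
rewrite big1 ?addr0// => l lj; rewrite !mxE (_ : _ == _ = false) ?mulr0//.
apply: contraNF lj => /eqP lE; apply/eqP/enum_val_inj.
by rewrite enum_rankK_in.
Qed.

End Subcols.

(** * Reduction of the marginal likelihood to an integral over [g] *)

Section Marginal.
Context {R : realType}.
Local Notation mu := (@lebesgue_measure R).

(** Scale parameter of the inverse-gamma law of the variance given [g] and the data: [b] plus half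
    the minimum over [c] of [|y - U c|^2 + |U c|^2 / g]. *)
Definition fit (b r s g : R) : R := b + (r + (s - r) / (1 + g)) / 2.

Definition evidence_density (b N : R) (n k : nat) (r s g : R) : R :=
  ig_kernel 2^-1 (n%:R / 2) g * (1 + g) `^ (- (k%:R / 2)) * fit b r s g `^ (- N).

Definition evidence (b N : R) (n k : nat) (r s : R) : \bar R :=
  (\int[mu]_(g in posR) (evidence_density b N n k r s g)%:E)%E.

Lemma fit_ge (b r s g : R) : r <= s -> 0 < g -> b + r / 2 <= fit b r s g.
Proof.
move=> rs g0; rewrite /fit lerD2l ler_pM2r ?invr_gt0// lerDl.
by apply: divr_ge0; [rewrite subr_ge0|apply: addr_ge0 => //; exact: ltW].
Qed.

Lemma fit_gt0 (b r s g : R) : 0 < b -> 0 <= r -> r <= s -> 0 < g -> 0 < fit b r s g.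
Proof.
move=> b0 r0 rs g0; apply: lt_le_trans (fit_ge b rs g0).
by rewrite ltr_pwDl// divr_ge0.
Qed.

Lemma evidence_density_ge0 b N n k r s g : 0 <= evidence_density b N n k r s g.
Proof. by rewrite !mulr_ge0 ?ig_kernel_ge0 ?powR_ge0. Qed.

Lemma measurable_evidence_density b N n k r s :
  measurable_fun (@posR R) (evidence_density b N n k r s).
Proof.
(* Division is written as the power [-1], which agrees with it on the positive axis and is
   measurable on the whole line. *)
pose f g : R := ig_kernel 2^-1 (n%:R / 2) g * (1 + g) `^ (- (k%:R / 2)) *
  (b + (r + (s - r) * (1 + g) `^ (-1)) / 2) `^ (- N).
apply: (@eq_measurable_fun _ _ _ _ _ f).
  move=> g; rewrite inE /posR /= => g0; rewrite /f /evidence_density /fit powR_inv1//.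
  by rewrite addr_ge0// ltW.
apply: measurable_funTS; rewrite /f.
have m1 e : measurable_fun [set: R] (fun g : R => (1 + g) `^ e).
  by apply: (measurableT_comp (measurable_powR _)); exact: measurable_funD.
apply: measurable_funM; first apply: measurable_funM => //.
  exact: measurable_ig_kernel.
apply: (measurableT_comp (measurable_powR _)); apply: measurable_funD => //.
apply: measurable_funM => //; apply: measurable_funD => //.
exact: measurable_funM.
Qed.

(** For [n > zeta] the ridge term [lam] is 0, so prior and posterior precisions are both multiples
    of the Gram matrix. Their ratio [t1 / t0 = 1 + g] yields the power of [1 + g], and the constant
    [D] cancels. *)
Lemma beta_marginal (zeta n p : nat) (X : 'M[R]_(n, p)) (S : {set 'I_p})
    (y : 'cV[R]_n) (g s2 : R) :
  (zeta < n)%N -> mx_injective (subcols X S) -> 0 < g -> 0 < s2 ->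
  let r := rss (subcols X S) y in let s := sqnorm y in
  iint (fun c : 'cV[R]_#|S| =>
     (gauss_pdf s2 (y - subcols X S *m c) * Defs.beta_pdf zeta X S g s2 c)%:E) =
  ((2 * pi * s2) `^ (- (n%:R / 2)) * (1 + g) `^ (- (#|S|%:R / 2)) *
   expR (- ((r + (s - r) / (1 + g)) / (2 * s2))))%:E.
Proof.
move=> zn iU g0 s0 r s; set U := subcols X S.
have [D [D0 _ HD]] := iint_gauss (gram_posdef iU); rewrite -/U in HD.
set t0 := (g * s2)^-1; have t00 : 0 < t0 by rewrite invr_gt0 mulr_gt0.
set k := #|S|%:R / 2.
have Ek c : (beta_kernel zeta X S g s2 c)%:E =
    (1 * expR (- (t0 / 2 * qform (U^T *m U) (c - 0))))%:E.
  rewrite mul1r /beta_kernel /Qprec /lam leqNgt zn /= raddf0 addr0 subr0.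
  rewrite -scalemxAr -scalemxAl mxE -/U -/t0 /qform; congr (expR (- _))%:E; ring.
have Dt : 0 < D * t0 `^ (- k) by rewrite mulr_gt0 ?powR_gt0.
have En : fine (iint (fun c => (beta_kernel zeta X S g s2 c)%:E)) = D * t0 `^ (- k).
  by rewrite (eq_iint Ek) (HD _ _ _ ler01 t00).2 /= mul1r.
set H := r + (s - r) / (1 + g).
set C := (2 * pi * s2) `^ (- (n%:R / 2)) * expR (- (H / (2 * s2))) / (D * t0 `^ (- k)).
have C0 : 0 <= C by rewrite divr_ge0 ?(ltW Dt)// mulr_ge0 ?powR_ge0 ?expR_ge0.
set t1 := (1 + g) * t0.
have g1 : 0 < 1 + g by rewrite addr_gt0.
have t10 : 0 < t1 by rewrite mulr_gt0.
set m := (g / (1 + g)) *: (invmx (U^T *m U) *m U^T *m y).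
have Ei c : (gauss_pdf s2 (y - U *m c) * Defs.beta_pdf zeta X S g s2 c)%:E =
   (C * expR (- (t1 / 2 * qform (U^T *m U) (c - m))))%:E.
  rewrite /Defs.beta_pdf En; have [->] := Ek c; rewrite mul1r subr0 /gauss_pdf /C.
  congr EFin; set A := _ `^ _; set Z := _ * _ `^ _.
  transitivity (A / Z * (expR (- (sqnorm (y - U *m c) / (2 * s2))) *
     expR (- (t0 / 2 * qform (U^T *m U) c)))); first by ring.
  transitivity (A / Z * (expR (- (H / (2 * s2))) *
     expR (- (t1 / 2 * qform (U^T *m U) (c - m))))); last by ring.
  rewrite -!expRD; congr (_ * expR _).
  have := complete_square iU y c g0 s0; rewrite -/t0 -/U -/m -/r -/s -/H -/t1 => E.
  have -> : - (sqnorm (y - U *m c) / (2 * s2)) - t0 / 2 * qform (U^T *m U) c =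
    - (sqnorm (y - U *m c) / s2 + t0 * qform (U^T *m U) c) / 2.
    by rewrite invfM; field; rewrite gt_eqF.
  by rewrite E; field; rewrite gt_eqF.
rewrite (eq_iint Ei) (HD _ _ _ C0 t10).2; congr EFin.
rewrite /C /t1 [((1 + g) * t0) `^ _]powRM ?(ltW g1) ?(ltW t00)// -/k; field.
by rewrite !gt_eqF ?powR_gt0.
Qed.

(** Collects the factors that do not depend on the model: the Gaussian constant, the Gamma factor of
    the variance integral, and the normalizers of both inverse-gamma priors. *)
Definition marg_const (a b : R) (n : nat) : R :=
  (2 * pi) `^ (- (n%:R / 2)) * ig_mass (n%:R / 2 + a) /
  ((n%:R / 2) `^ (- 2^-1) * ig_mass 2^-1 * (b `^ (- a) * ig_mass a)).

Lemma marg_const_gt0 (a b : R) (n : nat) : 0 < a -> 0 < b -> (0 < n)%N ->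
  0 < marg_const a b n.
Proof.
move=> a0 b0 n0; have n2 : 0 < n%:R / 2 :> R by rewrite divr_gt0 ?ltr0n.
have pi20 : 0 < 2 * pi :> R by rewrite mulr_gt0 ?pi_gt0.
by rewrite divr_gt0 ?mulr_gt0 ?powR_gt0 ?ig_mass_gt0 ?addr_gt0 ?invr_gt0.
Qed.

(** With the coefficients integrated out, the integrand in [s2] is an inverse-gamma kernel of shape
    [n / 2 + a] and scale [fit b r s g], so the inner integral is explicit. *)
Lemma margE (a b : R) (zeta n p : nat) (X : 'M[R]_(n, p)) (y : 'cV[R]_n)
    (S : {set 'I_p}) :
  0 < a -> 0 < b -> (zeta < n)%N -> mx_injective (subcols X S) ->
  marg a b zeta X y S =
  ((marg_const a b n)%:E *
   evidence b (n%:R / 2 + a) n #|S| (rss (subcols X S) y) (sqnorm y))%E.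
Proof.
move=> a0 b0 zn iU.
have n0 : (0 < n)%N by exact: leq_trans zn.
have n2 : 0 < n%:R / 2 :> R by rewrite divr_gt0 ?ltr0n.
have pi20 : 0 < 2 * pi :> R by rewrite mulr_gt0 ?pi_gt0.
have h0 : 0 < 2^-1 :> R by rewrite invr_gt0.
set r := rss _ _; set s := sqnorm y; set N := _ + a.
have N0 : 0 < N by rewrite addr_gt0.
have r0 : 0 <= r := rss_ge0 iU y.
have rs : r <= s := rss_le _ y.
rewrite /evidence -ge0_integralZl//; last 4 first.
- exact: measurable_posR.
- by apply/measurable_EFinP; exact: measurable_evidence_density.
- by move=> g _; rewrite lee_fin evidence_density_ge0.
- by rewrite lee_fin ltW// marg_const_gt0.
apply: eq_integral => g; rewrite inE /posR /= => g0.
set c := (2 * pi) `^ (- (n%:R / 2)) * (1 + g) `^ (- (#|S|%:R / 2)) *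
  (ig_kernel 2^-1 (n%:R / 2) g /
   ((n%:R / 2) `^ (- 2^-1) * ig_mass 2^-1 * (b `^ (- a) * ig_mass a))).
have c0 : 0 <= c.
  by rewrite !mulr_ge0 ?powR_ge0 ?ig_kernel_ge0// invr_ge0 ?mulr_ge0 ?powR_ge0// ltW// ig_mass_gt0.
have F0 := fit_gt0 b0 r0 rs g0.
have E s2 : s2 \in (posR : set R) ->
  (iint (fun c : 'cV[R]_#|S| =>
     (gauss_pdf s2 (y - subcols X S *m c) * Defs.beta_pdf zeta X S g s2 c)%:E)
   * (ig_pdf (2%:R)^-1 (n%:R / 2) g * ig_pdf a b s2)%:E)%E =
  (c%:E * (ig_kernel N (fit b r s g) s2)%:E)%E.
  rewrite inE /posR /= => s20; rewrite beta_marginal// -!EFinM -/r -/s; congr EFin.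
  rewrite /ig_pdf integral_ig_kernel//= integral_ig_kernel//= /ig_kernel s20.
  rewrite [(2 * pi * s2) `^ _]powRM ?(ltW pi20) ?(ltW s20)//.
  have -> : - N - 1 = - (n%:R / 2) + (- a - 1) by rewrite /N; ring.
  rewrite [s2 `^ (_ + (- a - 1))]powRD; last by apply/implyP => _; rewrite gt_eqF.
  have -> : - (fit b r s g / s2) =
    - ((r + (s - r) / (1 + g)) / (2 * s2)) + - (b / s2).
    by rewrite /fit invfM; field; rewrite !gt_eqF// addr_gt0.
  rewrite expRD /c; move: (ig_mass_gt0 a0) (ig_mass_gt0 h0) => m1 m2.
  by rewrite /ig_kernel g0; field; rewrite !gt_eqF ?powR_gt0.
transitivity (\int[mu]_(s2 in posR) (c%:E * (ig_kernel N (fit b r s g) s2)%:E))%E.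
  by apply: eq_integral => s2; exact: E.
rewrite ge0_integralZl//; last 3 first.
- exact: measurable_posR.
- by apply/measurable_EFinP; exact: measurable_funTS (measurable_ig_kernel _ _).
- by move=> x _; rewrite lee_fin ig_kernel_ge0.
rewrite integral_ig_kernel// -!EFinM; congr EFin.
by rewrite /c /evidence_density /marg_const; ring.
Qed.

End Marginal.

(** * Comparison of evidences at a fixed sample size *)

Section EvidenceBounds.
Context {R : realType}.
Local Notation mu := (@lebesgue_measure R).
Variables (b N : R).
Hypotheses (b0 : 0 < b) (N0 : 0 < N).

(** Lower bound on [[n, n + 1]] for the part of the evidence density other than the power of [fit];
    it decays only polynomially in [n]. *)
Definition evidence_low (n k : nat) : R :=
  n.+1%:R `^ (- 2^-1 - 1) * expR (- 2^-1) * n.+2%:R `^ (- (k%:R / 2)).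

Lemma evidence_low_gt0 n k : 0 < evidence_low n k.
Proof. by rewrite !mulr_gt0 ?powR_gt0 ?expR_gt0. Qed.

Lemma ler_powRN (x y p : R) : 0 < x -> x <= y -> 0 <= p -> y `^ (- p) <= x `^ (- p).
Proof.
move=> x0 xy p0; have y0 := lt_le_trans x0 xy.
rewrite !powRN lef_pV2 ?posrE ?powR_gt0// ge0_ler_powR ?nnegrE//; exact: ltW.
Qed.

Lemma powRN_le1 (x p : R) : 1 <= x -> 0 <= p -> x `^ (- p) <= 1.
Proof. by move=> x1 p0; apply: le_trans (ler_powRN ltr01 x1 p0) _; rewrite powR1. Qed.

Lemma fit_nonincreasing (r s g G : R) : r <= s -> 0 < g -> g <= G ->
  fit b r s G <= fit b r s g.
Proof.
move=> rs g0 gG; rewrite /fit lerD2l ler_pM2r ?invr_gt0// lerD2l.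
apply: ler_wpM2l; first by rewrite subr_ge0.
by rewrite lef_pV2 ?posrE ?lerD2l// addr_gt0// (lt_le_trans g0).
Qed.

Lemma evidence_le n k (r s : R) : (0 < n)%N -> 0 <= r -> r <= s ->
  (evidence b N n k r s <=
   ((b + r / 2) `^ (- N) * ((n%:R / 2) `^ (- 2^-1) * ig_mass 2^-1))%:E)%E.
Proof.
move=> n0 r0 rs.
have n2 : 0 < n%:R / 2 :> R by rewrite divr_gt0 ?ltr0n.
have hr : 0 <= r / 2 by exact: divr_ge0.
have br : 0 < b + r / 2 by move: b0; lra.
rewrite EFinM -integral_ig_kernel ?invr_gt0// -ge0_integralZl//; last 4 first.
- exact: measurable_posR.
- by apply/measurable_EFinP; exact: measurable_funTS (measurable_ig_kernel _ _).
- by move=> x _; rewrite lee_fin ig_kernel_ge0.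
- by rewrite lee_fin powR_ge0.
apply: ge0_le_integral => //.
- exact: measurable_posR.
- by move=> x _; rewrite lee_fin evidence_density_ge0.
- by apply/measurable_EFinP; exact: measurable_evidence_density.
- apply/measurable_EFinP; apply: measurable_funM => //.
  exact: measurable_funTS (measurable_ig_kernel _ _).
move=> g g0; rewrite -EFinM lee_fin /evidence_density mulrC.
apply: ler_pM; rewrite ?powR_ge0 ?mulr_ge0 ?powR_ge0 ?ig_kernel_ge0//.
  by apply: ler_powRN => //; [exact: fit_ge|exact: ltW].
rewrite ler_piMr ?ig_kernel_ge0// powRN_le1 ?divr_ge0// lerDl; exact: ltW.
Qed.

(** Only the unit interval [[n, n + 1]] is kept. As [fit] decreases in [g], its value at any
    [G <= n] bounds it there; leaving [G] free allows both [G = n] and a constant [G] later. *)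
Lemma evidence_ge n k (r s G : R) : (0 < n)%N -> 0 <= r -> r <= s ->
  0 < G -> G <= n%:R ->
  ((evidence_low n k * fit b r s G `^ (- N))%:E <= evidence b N n k r s)%E.
Proof.
move=> n0 r0 rs G0 Gn.
have nn0 : 0 < n%:R :> R by rewrite ltr0n.
apply: (@ge0_integral_posR_lower _ _ _ n%:R) => //.
- by rewrite mulr_ge0 ?powR_ge0 ?ltW ?evidence_low_gt0.
- exact: measurable_evidence_density.
- by move=> x _; exact: evidence_density_ge0.
move=> g /andP[ng gn]; have g0 : 0 < g := lt_le_trans nn0 ng.
have gn' : g <= n.+1%:R by rewrite -natr1.
rewrite /evidence_low /evidence_density.
apply: ler_pM; rewrite ?powR_ge0 ?mulr_ge0 ?powR_ge0 ?expR_ge0//; last first.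
  apply: ler_powRN; [exact: fit_gt0| |exact: ltW].
  by apply: fit_nonincreasing => //; exact: le_trans ng.
apply: ler_pM; rewrite ?powR_ge0 ?mulr_ge0 ?powR_ge0 ?expR_ge0//; last first.
  apply: ler_powRN; [exact: addr_gt0| |exact: divr_ge0].
  by rewrite -natr1 addrC lerD2r.
rewrite /ig_kernel g0; apply: ler_pM; rewrite ?powR_ge0 ?expR_ge0//.
  rewrite -opprD; apply: ler_powRN => //; exact: addr_ge0.
rewrite ler_expR lerN2 ler_pdivrMr// mulrC ler_pM2l ?invr_gt0//.
Qed.

Lemma evidence_fin n k (r s : R) : (0 < n)%N -> 0 <= r -> r <= s ->
  exists2 v : R, 0 < v & evidence b N n k r s = v%:E.
Proof.
move=> n0 r0 rs; have nn0 : 0 < n%:R :> R by rewrite ltr0n.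
have lo := evidence_ge k n0 r0 rs nn0 (lexx _).
have hi := evidence_le k n0 r0 rs.
have lo0 : 0 < evidence_low n k * fit b r s n%:R `^ (- N).
  by rewrite mulr_gt0 ?evidence_low_gt0 ?powR_gt0 ?fit_gt0.
case: (evidence b N n k r s) lo hi => [v| |] //=; rewrite ?lee_fin => lo hi.
by exists v => //; exact: lt_le_trans lo.
Qed.

(** Divides the upper bound for the wrong model by the lower bound for the other one at [G = n]. *)
Lemma evidence_nonnested n k k' (r s r' : R) : (0 < n)%N -> 0 <= r -> r <= s ->
  0 <= r' -> r' <= s ->
  (evidence b N n k' r' s <=
   (((n%:R / 2) `^ (- 2^-1) * ig_mass 2^-1) / evidence_low n k *
     (fit b r s n%:R / (b + r' / 2)) `^ N)%:E * evidence b N n k r s)%E.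
Proof.
move=> n0 r0 rs r0' rs'; have nn0 : 0 < n%:R :> R by rewrite ltr0n.
have F0 := fit_gt0 b0 r0 rs nn0.
have hr : 0 <= r' / 2 by exact: divr_ge0.
have br : 0 < b + r' / 2 by move: b0; lra.
apply: le_trans (evidence_le k' n0 r0' rs') _.
have m0 : 0 < ig_mass 2^-1 :> R by rewrite ig_mass_gt0 ?invr_gt0.
apply: le_trans (lee_wpmul2l _ (evidence_ge k n0 r0 rs nn0 (lexx _))); last first.
  by rewrite lee_fin !mulr_ge0 ?powR_ge0 ?invr_ge0 ?ltW ?evidence_low_gt0.
rewrite -EFinM lee_fin powRM ?invr_ge0 ?(ltW br) ?(ltW F0)//.
rewrite -[(b + r' / 2)^-1]powR_inv1 ?(ltW br)// -powRrM mulN1r.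
rewrite [fit b r s n%:R `^ (- N)]powRN le_eqVlt; apply/orP; left; apply/eqP; field.
by rewrite !gt_eqF ?powR_gt0 ?evidence_low_gt0.
Qed.

(** The integral is split at [g = G]. Above [G], the extra column contributes at most
    [(1 + G) ^ (- 1 / 2)]. Below [G], the prior of [g] is exponentially small in [n], and the lower
    bound [evidence_ge] at the same [G] absorbs the power of [fit]. The condition on [K] keeps the
    change in that power below [expR K]. *)
Lemma evidence_nested n k k' (r s r' G K : R) : (0 < n)%N -> 0 <= r' -> r' <= r ->
  r <= s -> (k < k')%N -> 0 < G -> G <= n%:R ->
  N * (r - r') <= K * (2 * b + r') ->
  (evidence b N n k' r' s <=
   (expR K * ((1 + G) `^ (- 2^-1) +
      expR (- (n%:R / (4 * G))) * (4^-1 `^ (- 2^-1) * ig_mass 2^-1) / evidence_low n k))%:E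
     * evidence b N n k r s)%E.
Proof.
move=> n0 r0' rr' rs kk' G0 Gn HK.
have r0 : 0 <= r := le_trans r0' rr'.
have rs' : r' <= s := le_trans rr' rs.
have nn0 : 0 < n%:R :> R by rewrite ltr0n.
have n1 : 1 <= n%:R :> R by rewrite ler1n.
have FG := fit_gt0 b0 r0 rs G0.
have q0 : 0 < 4^-1 :> R by rewrite invr_gt0.
have m0 : 0 < ig_mass 2^-1 :> R by rewrite ig_mass_gt0 ?invr_gt0.
pose c1 := expR K * (1 + G) `^ (- 2^-1).
pose c2 := expR K * expR (- (n%:R / (4 * G))) * fit b r s G `^ (- N).
have c10 : 0 <= c1 by rewrite mulr_ge0 ?expR_ge0 ?powR_ge0.
have c20 : 0 <= c2 by rewrite !mulr_ge0 ?expR_ge0 ?powR_ge0.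
have me D : measurable_fun D (EFin \o ig_kernel 2^-1 4^-1 : R -> \bar R).
  by apply/measurable_EFinP; exact: measurable_funTS (measurable_ig_kernel _ _).
have md k1 r1 : measurable_fun (@posR R) (EFin \o evidence_density b N n k1 r1 s).
  by apply/measurable_EFinP; exact: measurable_evidence_density.
have H : (evidence b N n k' r' s <=
    c1%:E * evidence b N n k r s + c2%:E * (4^-1 `^ (- 2^-1) * ig_mass 2^-1)%:E)%E.
  rewrite -integral_ig_kernel ?invr_gt0// -ge0_integralZl//; last 3 first.
  - exact: measurable_posR.
  - exact: md.
  - by move=> x _; rewrite lee_fin evidence_density_ge0.
  rewrite -ge0_integralZl//; last 3 first.
  - exact: measurable_posR.
  - exact: me.
  - by move=> x _; rewrite lee_fin ig_kernel_ge0.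
  rewrite -ge0_integralD//; last 5 first.
  - exact: measurable_posR.
  - by move=> x _; rewrite mule_ge0 ?lee_fin ?evidence_density_ge0.
  - by apply: measurable_funeM; exact: md.
  - by move=> x _; rewrite mule_ge0 ?lee_fin ?ig_kernel_ge0.
  - by apply: measurable_funeM; exact: me.
  apply: ge0_le_integral => //.
  - exact: measurable_posR.
  - by move=> x _; rewrite lee_fin evidence_density_ge0.
  - exact: md.
  - by apply: emeasurable_funD; apply: measurable_funeM; [exact: md|exact: me].
  move=> g g0; rewrite -!EFinM -EFinD lee_fin.
  have g1 : 0 < 1 + g by exact: addr_gt0.
  have F0 := fit_gt0 b0 r0 rs g0; have F0' := fit_gt0 b0 r0' rs' g0.
  have HF : fit b r' s g `^ (- N) <= expR K * fit b r s g `^ (- N).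
    (* The relative increase of [fit] from [r'] to [r] is at most [K / N], and
       [1 + K / N <= expR (K / N)]; the power [N] then gives [expR K]. *)
    have ratio : fit b r s g <= fit b r' s g * expR (K / N).
      have h1 : fit b r s g - fit b r' s g <= (r - r') / 2.
        rewrite (_ : _ - _ = (r - r') / 2 * (1 - (1 + g)^-1)); last by rewrite /fit; field; rewrite gt_eqF.
        rewrite ler_piMr ?divr_ge0 ?subr_ge0// gerBl invr_ge0; exact: ltW.
      have h2 : (r - r') / 2 <= K / N * fit b r' s g.
        have h3 := fit_ge b rs' g0.
        have K0 : 0 <= K.
          have : 0 <= K * (2 * b + r') by apply: le_trans HK; apply: mulr_ge0; [exact: ltW|rewrite subr_ge0].
          have h8 : 0 < 2 * b + r' by apply: ltr_pwDl => //; exact: mulr_gt0.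
          by rewrite pmulr_lge0.
        apply: le_trans (ler_wpM2l (divr_ge0 K0 (ltW N0)) h3).
        rewrite mulrAC ler_pdivlMr//; move: HK; lra.
      have h4 := expR_ge1Dx (K / N).
      have := ler_wpM2l (ltW F0') h4; rewrite mulrDr mulr1; move: h1 h2; lra.
    have := ge0_ler_powR (ltW N0) _ _ ratio.
    rewrite !nnegrE (ltW F0) mulr_ge0 ?expR_ge0 ?(ltW F0')// => /(_ isT isT).
    rewrite powRM ?expR_ge0 ?(ltW F0')// -expRM divfK ?gt_eqF// => h.
    rewrite !powRN ler_pdivlMr ?powR_gt0// mulrC ler_pdivrMr ?powR_gt0//.
    by rewrite mulrC.
  have Hk : (1 + g) `^ (- (k'%:R / 2)) <= (1 + g) `^ (- (k%:R / 2)) * (1 + g) `^ (- 2^-1).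
    rewrite -powRD; last by apply/implyP => _; rewrite gt_eqF.
    apply: ler_powR; first by rewrite lerDl ltW.
    have : (k%:R + 1 <= k'%:R :> R) by rewrite natr1 ler_nat.
    lra.
  apply: (@le_trans _ _ (expR K * (1 + g) `^ (- 2^-1) * evidence_density b N n k r s g)).
    rewrite /evidence_density; set kg := ig_kernel _ _ _; have kg0 : 0 <= kg by exact: ig_kernel_ge0.
    apply: (@le_trans _ _ (kg * ((1 + g) `^ (- (k%:R / 2)) * (1 + g) `^ (- 2^-1)) *
       (expR K * fit b r s g `^ (- N)))).
      apply: ler_pM; rewrite ?mulr_ge0 ?powR_ge0//.
      exact: ler_wpM2l.
    by rewrite le_eqVlt; apply/orP; left; apply/eqP; ring.
  have d0 := evidence_density_ge0 b N n k r s g.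
  have [gG|Gg] := leP g G; last first.
    apply: (@le_trans _ _ (c1 * evidence_density b N n k r s g)).
      apply: ler_wpM2r => //; apply: ler_wpM2l; first exact: expR_ge0.
      apply: ler_powRN; first exact: addr_gt0.
        by rewrite lerD2l ltW.
      by rewrite invr_ge0.
    by rewrite lerDl mulr_ge0 ?ig_kernel_ge0.
  apply: (@le_trans _ _ (c2 * ig_kernel 2^-1 4^-1 g)); last first.
    by rewrite lerDr mulr_ge0.
  (* The exponent [n / (2 g)] is cut into two equal halves: one gives the small factor since
     [g <= G], the other is at least [4^-1 / g] and keeps the kernel integrable uniformly in [n]. *)
  have h5 : ig_kernel 2^-1 (n%:R / 2) g <= expR (- (n%:R / (4 * G))) * ig_kernel 2^-1 4^-1 g.
    rewrite /ig_kernel g0 mulrCA ler_wpM2l ?powR_ge0// -expRD ler_expR.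
    have e1 : n%:R / (4 * G) <= n%:R / (4 * g).
      by rewrite ler_pM2l// lef_pV2 ?posrE ?mulr_gt0// ler_pM2l.
    have e2 : 4^-1 / g <= n%:R / (4 * g).
      by rewrite invfM mulrA ler_pM2r ?invr_gt0// ler_peMl// ltW.
    have e3 : n%:R / 2 / g = n%:R / (4 * g) + n%:R / (4 * g) by field; rewrite gt_eqF.
    rewrite e3; lra.
  have h6 : evidence_density b N n k r s g <=
     expR (- (n%:R / (4 * G))) * ig_kernel 2^-1 4^-1 g * fit b r s G `^ (- N).
    rewrite /evidence_density; apply: ler_pM; rewrite ?mulr_ge0 ?powR_ge0 ?ig_kernel_ge0//.
      rewrite -[leRHS]mulr1; apply: ler_pM; rewrite ?powR_ge0 ?ig_kernel_ge0//.
      by rewrite powRN_le1 ?divr_ge0// lerDl ltW.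
    apply: ler_powRN => //; last exact: ltW.
    exact: fit_nonincreasing.
  have h7 : (1 + g) `^ (- 2^-1) <= 1 by rewrite powRN_le1 ?invr_ge0// lerDl ltW.
  apply: (@le_trans _ _ (expR K * 1 * (expR (- (n%:R / (4 * G))) *
      ig_kernel 2^-1 4^-1 g * fit b r s G `^ (- N)))).
    apply: ler_pM => //; rewrite ?mulr_ge0 ?expR_ge0 ?powR_ge0//.
    by apply: ler_wpM2l => //; exact: expR_ge0.
  by rewrite le_eqVlt; apply/orP; left; apply/eqP; rewrite /c2; ring.
apply: le_trans H _.
have [v v0 Ev] := evidence_fin k n0 r0 rs.
(* The term from below [G] still carries [fit] at [G] to the power [- N]; the lower bound trades it
   for the evidence of the smaller model over [evidence_low]. *)
have := evidence_ge k n0 r0 rs G0 Gn; rewrite Ev -!EFinM -EFinD !lee_fin => lo.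
rewrite mulrDr mulrDl lerD2l /c2.
have el := evidence_low_gt0 n k.
move: lo; rewrite mulrC -ler_pdivlMr// => lo.
set e := expR (- _); set z := _ * ig_mass _.
have z0 : 0 <= expR K * e * z by rewrite !mulr_ge0 ?expR_ge0 ?powR_ge0 ?ltW.
rewrite [leLHS](_ : _ = expR K * e * z * fit b r s G `^ (- N)); last by ring.
apply: le_trans (ler_wpM2l z0 lo) _.
by rewrite le_eqVlt; apply/orP; left; apply/eqP; field; rewrite gt_eqF.
Qed.

End EvidenceBounds.

(** * Evidence ratios as the sample size grows, uniformly in the data *)

Section Asymptotics.
Context {R : realType}.

(** Since [expR x >= x ^+ m.+1 / m.+1!] for [x >= 0], and [n + 2 <= 3 n] for [n >= 1], the left side
    is at most [K / n]. *)
Lemma poly_expR_small (m : nat) (C t eps : R) : 0 <= C -> 0 < t -> 0 < eps ->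
  \forall n \near \oo, C * n.+2%:R ^+ m * expR (- (t * n%:R)) < eps.
Proof.
move=> C0 t0 eps0.
pose K := C * 3 ^+ m * m.+1`!%:R / t ^+ m.+1.
have K0 : 0 <= K by rewrite /K !mulr_ge0 ?invr_ge0 ?exprn_ge0 ?(ltW t0).
near=> n.
have n0 : (0 < n)%N by near: n; exact: nbhs_infty_gt.
have nn0 : 0 < n%:R :> R by rewrite ltr0n.
have Kn : K / eps < n%:R by near: n; exact: nbhs_infty_gtr.
have tn0 : 0 < t * n%:R by rewrite mulr_gt0.
have f0 : 0 < m.+1`!%:R :> R by rewrite ltr0n fact_gt0.
have h1 : expR (- (t * n%:R)) <= m.+1`!%:R / (t * n%:R) ^+ m.+1.
  rewrite expRN -[leRHS]invrK lef_pV2 ?posrE ?expR_gt0 ?invr_gt0 ?divr_gt0 ?exprn_gt0//.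
  rewrite invf_div; apply: le_trans (expR_ge1Dxn m (ltW tn0)).
  by rewrite lerDr.
have h2 : n.+2%:R ^+ m <= 3 ^+ m * n%:R ^+ m :> R.
  rewrite -exprMn lerXn2r ?nnegrE ?mulr_ge0//.
  rewrite -natrM ler_nat; lia.
apply: (@le_lt_trans _ _ (K / n%:R)); last first.
  by rewrite ltr_pdivrMr// mulrC -ltr_pdivrMr.
apply: (@le_trans _ _ (C * (3 ^+ m * n%:R ^+ m) * (m.+1`!%:R / (t * n%:R) ^+ m.+1))).
  apply: ler_pM; rewrite ?mulr_ge0 ?expR_ge0 ?exprn_ge0//.
  exact: ler_wpM2l.
rewrite le_eqVlt; apply/orP; left; apply/eqP; rewrite /K exprMn !exprS.
by field; rewrite !gt_eqF ?exprn_gt0.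
Unshelve. all: by end_near. Qed.

Lemma evidence_low_inv (n k : nat) :
  (evidence_low n k : R)^-1 <= 2 * n.+2%:R ^+ (k + 2).
Proof.
rewrite /evidence_low !invfM -!powRN -expRN !opprK.
have n1 : 1 <= n.+2%:R :> R by rewrite ler1n.
have h1 : n.+1%:R `^ (- (- 2^-1 - 1)) <= n.+2%:R ^+ 2 :> R.
  have -> : - (- 2^-1 - 1) = 2^-1 + 1 :> R by ring.
  apply: (@le_trans _ _ (n.+2%:R `^ (2^-1 + 1))).
    by apply: ge0_ler_powR; rewrite ?nnegrE ?ler_nat//.
  rewrite -powR_mulrn//; apply: ler_powR => //; lra.
have h2 : n.+2%:R `^ (k%:R / 2) <= n.+2%:R ^+ k :> R.
  rewrite -powR_mulrn//; apply: ler_powR => //.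
  have : 0 <= k%:R :> R by []. lra.
have h3 := @expR_half_le2 R.
rewrite exprD (_ : 2 * _ = n.+2%:R ^+ 2 * 2 * n.+2%:R ^+ k); last by ring.
by apply: ler_pM; rewrite ?mulr_ge0 ?powR_ge0 ?expR_ge0//; exact: ler_pM.
Qed.

(** [G] is fixed first, making the term from above it at most [eps / 2]; then [n] is taken large
    enough for the exponentially small remainder. The threshold on [n] is chosen before [r], [s],
    [r'], so it applies to random data. *)
Lemma evidence_nested_small (a b : R) (k k' : nat) (M c eps : R) :
  0 < a -> 0 < b -> (k < k')%N -> 0 <= M -> 0 < c -> 0 < eps ->
  \forall n \near \oo, forall r s r' : R,
    0 <= r' -> r' <= r -> r <= s -> r - r' <= M -> c * n%:R <= r' ->
    (evidence b (n%:R / 2 + a) n k' r' s <=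
     eps%:E * evidence b (n%:R / 2 + a) n k r s)%E.
Proof.
move=> a0 b0 kk' M0 c0 eps0.
(* For [n >= 1] the power [n / 2 + a] is at most [(2^-1 + a) * n], while [r' >= c * n]: the factors
   [n] cancel and [K] is constant. *)
pose K := (2^-1 + a) * M / c.
have h0 : 0 < 2^-1 :> R by rewrite invr_gt0.
have ha : 0 <= 2^-1 + a by rewrite addr_ge0 ?ltW.
have K0 : 0 <= K by rewrite divr_ge0 ?mulr_ge0// ltW.
pose G := (2 * expR K / eps) ^+ 2.
have u0 : 0 < 2 * expR K / eps by rewrite divr_gt0 ?mulr_gt0 ?expR_gt0.
have G0 : 0 < G by rewrite exprn_gt0.
have HG : expR K * (1 + G) `^ (- 2^-1) <= eps / 2.
  apply: (@le_trans _ _ (expR K * G `^ (- 2^-1))).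
    rewrite ler_wpM2l ?expR_ge0//; apply: ler_powRN => //.
    by rewrite lerDr.
  rewrite powRN powR12_sqrt ?(ltW G0)// sqrtr_sqr ger0_norm ?(ltW u0)//.
  rewrite le_eqVlt; apply/orP; left; apply/eqP; field.
  by rewrite !gt_eqF ?expR_gt0.
have m0 : 0 < ig_mass 2^-1 :> R by rewrite ig_mass_gt0.
pose Z : R := 4^-1 `^ (- 2^-1) * ig_mass 2^-1.
have Z0 : 0 <= Z by rewrite mulr_ge0 ?powR_ge0 ?ltW.
have C0 : 0 <= expR K * Z * 2 by rewrite !mulr_ge0 ?expR_ge0 ?powR_ge0 ?(ltW m0).
have t0 : 0 < (4 * G)^-1 by rewrite invr_gt0 mulr_gt0.
have e20 : 0 < eps / 2 by rewrite divr_gt0.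
near=> n => r s r' r0' rr' rs rM cr.
have n0 : (0 < n)%N by near: n; exact: nbhs_infty_gt.
have nn0 : 0 < n%:R :> R by rewrite ltr0n.
have n1 : 1 <= n%:R :> R by rewrite ler1n.
have Gn : G <= n%:R by near: n; exact: nbhs_infty_ger.
have small : expR K * Z * 2 * n.+2%:R ^+ (k + 2) * expR (- ((4 * G)^-1 * n%:R)) < eps / 2.
  by near: n; exact: poly_expR_small.
set N := n%:R / 2 + a.
have N0 : 0 < N by rewrite addr_gt0 ?divr_gt0.
have HK : N * (r - r') <= K * (2 * b + r').
  apply: (@le_trans _ _ ((2^-1 + a) * n%:R * M)).
    apply: ler_pM => //; rewrite ?subr_ge0 ?(ltW N0)//.
    rewrite /N mulrDl; have := ler_wpM2l (ltW a0) n1; lra.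
  apply: (@le_trans _ _ (K * (c * n%:R))).
    by rewrite le_eqVlt; apply/orP; left; apply/eqP; rewrite /K; field; rewrite gt_eqF.
  by apply: ler_wpM2l => //; apply: le_trans cr _; rewrite lerDr mulr_ge0// ltW.
apply: le_trans (evidence_nested b0 N0 n0 r0' rr' rs kk' G0 Gn HK) _.
apply: lee_wpmul2r.
  by apply: integral_ge0 => x _; rewrite lee_fin evidence_density_ge0.
rewrite lee_fin mulrDr [leRHS](splitr eps); apply: lerD => //.
apply: le_trans (ltW small).
rewrite -/Z (_ : - (n%:R / (4 * G)) = - ((4 * G)^-1 * n%:R)); last by rewrite mulrC.
set e := expR (- _).
have el := evidence_low_inv n k.
have w0 : 0 <= expR K * Z * e by rewrite mulr_ge0 ?expR_ge0 ?(mulr_ge0 (expR_ge0 _) Z0).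
have := ler_wpM2l w0 el; congr (_ <= _); ring.
Unshelve. all: by end_near. Qed.

(** At [g = n] the shrinkage term of [fit] is bounded by [C], so the gap [d * n] in [r] survives as
    a relative gap of at least [d / (4 * B)]. Raised to a power of order [n / 2], it beats the
    polynomial loss from [evidence_low]. *)
Lemma evidence_nonnested_small (a b : R) (k k' : nat) (C d eps : R) :
  0 < a -> 0 < b -> 0 <= C -> 0 < d -> 0 < eps ->
  \forall n \near \oo, forall r s r' : R,
    0 <= r -> r <= s -> r' <= s -> s <= C * n%:R -> r + d * n%:R <= r' ->
    (evidence b (n%:R / 2 + a) n k' r' s <=
     eps%:E * evidence b (n%:R / 2 + a) n k r s)%E.
Proof.
move=> a0 b0 C0 d0 eps0.
have h0 : 0 < 2^-1 :> R by rewrite invr_gt0.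
have m0 : 0 < ig_mass 2^-1 :> R by rewrite ig_mass_gt0.
pose Z : R := 2^-1 `^ (- 2^-1) * ig_mass 2^-1.
have Z0 : 0 <= Z by rewrite mulr_ge0 ?powR_ge0 ?ltW.
pose B := b + C + d.
have B0 : 0 < B by rewrite /B; lra.
have t0 : 0 < d / (8 * B) by rewrite divr_gt0 ?mulr_gt0.
have Z20 : 0 <= Z * 2 by rewrite mulr_ge0.
near=> n => r s r' r0 rs rs' sC rr'.
have n0 : (0 < n)%N by near: n; exact: nbhs_infty_gt.
have nn0 : 0 < n%:R :> R by rewrite ltr0n.
have n1 : 1 <= n%:R :> R by rewrite ler1n.
have nC : 2 * C / d < n%:R by near: n; exact: nbhs_infty_gtr.
have small : Z * 2 * n.+2%:R ^+ (k + 2) * expR (- (d / (8 * B) * n%:R)) < eps.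
  by near: n; exact: poly_expR_small.
set N := n%:R / 2 + a.
have N0 : 0 < N by rewrite addr_gt0 ?divr_gt0.
have dn0 : 0 < d * n%:R by rewrite mulr_gt0.
have r0' : 0 <= r' by lra.
apply: le_trans (evidence_nonnested b0 N0 k k' n0 r0 rs r0' rs') _.
apply: lee_wpmul2r.
  by apply: integral_ge0 => x _; rewrite lee_fin evidence_density_ge0.
rewrite lee_fin; apply: le_trans (ltW small).
(* [v] is a lower bound for [b + r' / 2]. Once [C <= d * n / 2], [fit] at [n] is at most
   [v - d * n / 4], and [v <= B * n] makes this gap relative. *)
pose v := b + r / 2 + d * n%:R / 2.
have v0 : 0 < v by rewrite /v; lra.
have F0 := fit_gt0 b0 r0 rs nn0.
have hu : fit b r s n%:R <= b + r / 2 + C / 2.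
  rewrite /fit mulrDl addrA lerD2l ler_pM2r//.
  rewrite ler_pdivrMr; last by lra.
  apply: (@le_trans _ _ (C * n%:R)); first by lra.
  by apply: ler_wpM2l => //; lra.
have hC : C <= d * n%:R / 2.
  by move: nC; rewrite ltr_pdivrMr// => nC; lra.
have hv : v <= B * n%:R.
  have hb : b <= b * n%:R by rewrite ler_peMr// ltW.
  rewrite /v /B !mulrDl; lra.
have hq : fit b r s n%:R / (b + r' / 2) <= expR (- (d / (4 * B))).
  apply: (@le_trans _ _ (fit b r s n%:R / v)).
    rewrite ler_wpM2l ?(ltW F0)// lef_pV2 ?posrE//; rewrite /v; lra.
  apply: le_trans (expR_ge1Dx _).
  rewrite ler_pdivrMr// mulrDl mul1r mulNr lerBrDr.
  have : d / (4 * B) * v <= d * n%:R / 4.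
    have dB : 0 <= d / (4 * B) by rewrite divr_ge0 ?mulr_ge0// ltW.
    apply: le_trans (ler_wpM2l dB hv) _.
    by rewrite le_eqVlt; apply/orP; left; apply/eqP; field; rewrite gt_eqF.
  set x := d / _ * v => hx; have vE : v = b + r / 2 + d * n%:R / 2 by [].
  by rewrite vE; lra.
have br : 0 < b + r' / 2 by lra.
have hp : (fit b r s n%:R / (b + r' / 2)) `^ N <= expR (- (d / (8 * B) * n%:R)).
  apply: (@le_trans _ _ (expR (- (d / (4 * B))) `^ N)).
    by rewrite ge0_ler_powR ?nnegrE ?expR_ge0 ?divr_ge0 ?(ltW F0) ?(ltW br) ?(ltW N0).
  rewrite -expRM ler_expR mulNr lerN2 /N (mulrDr (d / (4 * B))).
  have : 0 <= d / (4 * B) * a by rewrite !mulr_ge0 ?invr_ge0 ?mulr_ge0 ?(ltW d0) ?(ltW a0) ?(ltW B0).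
  have -> : d / (4 * B) * (n%:R / 2) = d / (8 * B) * n%:R by field; rewrite gt_eqF.
  lra.
have hz : (n%:R / 2) `^ (- 2^-1) * ig_mass 2^-1 <= Z.
  rewrite ler_wpM2r ?(ltW m0)//; apply: ler_powRN => //.
  by apply: ler_peMl => //; exact: ltW.
apply: ler_pM => //; rewrite ?powR_ge0//.
  by rewrite !mulr_ge0 ?powR_ge0 ?invr_ge0 ?(ltW m0)// ltW// evidence_low_gt0.
rewrite -[leRHS]mulrA; apply: ler_pM => //.
- by rewrite mulr_ge0 ?powR_ge0 ?(ltW m0).
- by rewrite invr_ge0 ltW// evidence_low_gt0.
exact: evidence_low_inv.
Unshelve. all: by end_near. Qed.

End Asymptotics.

(** * Residual sums of squares under signal plus noise *)

Section RssComparison.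
Context {R : realType}.

Lemma sqnormD n (u v : 'cV[R]_n) :
  sqnorm (u + v) = sqnorm u + 2 * (u^T *m v) 0 0 + sqnorm v.
Proof.
rewrite /sqnorm mxE mulr_sumr -!big_split /=; apply: eq_bigr => i _.
by rewrite !mxE; ring.
Qed.

Lemma sqnormD_le n (u v : 'cV[R]_n) : sqnorm (u + v) <= 2 * sqnorm u + 2 * sqnorm v.
Proof.
rewrite /sqnorm !mulr_sumr -big_split /=; apply: ler_sum => i _; rewrite mxE.
by have := sqr_ge0 (u i 0 - v i 0); nra.
Qed.

(** Cauchy-Schwarz in each row, then exchange of the sums to use the bound on the columns. *)
Lemma sqnorm_mulmx_le n k (U : 'M[R]_(n, k)) (c : 'cV[R]_k) (q : R) :
  (forall j, \sum_i (U i j) ^+ 2 <= q) ->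
  sqnorm (U *m c) <= k%:R * sqnorm c * q.
Proof.
move=> Uq; have CS (x : 'I_k -> R) : (\sum_j x j) ^+ 2 <= k%:R * \sum_j (x j) ^+ 2.
  rewrite expr2 big_distrlr /=.
  apply: (@le_trans _ _ (\sum_i \sum_j ((x i) ^+ 2 / 2 + (x j) ^+ 2 / 2))).
    apply: ler_sum => i _; apply: ler_sum => j _.
    by have := sqr_ge0 (x i - x j); nra.
  under [leLHS]eq_bigr => i _ do rewrite big_split /= sumr_const card_ord.
  rewrite big_split /= sumr_const card_ord sumrMnl -mulrnDl -mulr_suml -splitr.
  by rewrite mulr_natl.
apply: (@le_trans _ _ (\sum_i k%:R * \sum_j (U i j * c j 0) ^+ 2)).
  by apply: ler_sum => i _; rewrite mxE; exact: CS.
rewrite -mulr_sumr -mulrA ler_wpM2l// exchange_big /= mulr_suml.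
apply: ler_sum => j _; under eq_bigr do rewrite exprMn.
by rewrite -mulr_suml mulrC ler_wpM2l ?sqr_ge0.
Qed.

Lemma rss_shift n k (U : 'M[R]_(n, k)) (c : 'cV[R]_k) (e : 'cV[R]_n) :
  mx_injective U -> rss U (U *m c + e) = rss U e.
Proof.
move=> iU; rewrite !rss_sqnorm// mulmxDr mulmxA mulmxBl mul1mx.
by rewrite proj_mx_onto_id// subrr mul0mx add0r.
Qed.

(** Nested column spaces give [P *m P' = P], and a projection does not increase the norm of
    [P' *m e]. *)
Lemma sqnorm_proj_nested n k k' (U : 'M[R]_(n, k)) (U' : 'M[R]_(n, k'))
    (C : 'M[R]_(k', k)) (e : 'cV[R]_n) :
  mx_injective U -> mx_injective U' -> U = U' *m C ->
  sqnorm (proj_mx_onto U *m e) <= sqnorm (proj_mx_onto U' *m e).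
Proof.
move=> iU iU' UE.
have PU : U^T *m proj_mx_onto U' = U^T.
  by rewrite -[LHS]trmxK trmx_mul proj_mx_onto_sym trmxK {1}UE mulmxA proj_mx_onto_id// -UE.
have PP : proj_mx_onto U *m proj_mx_onto U' = proj_mx_onto U.
  by rewrite {1 3}/proj_mx_onto -(mulmxA _ U^T) PU.
rewrite -PP -mulmxA; have := rss_ge0 iU (proj_mx_onto U' *m e).
by rewrite /rss subr_ge0.
Qed.

(** [w] already lies in the range of the complementary projection, which can therefore be dropped
    from the noise in the cross term. *)
Lemma rss_signal n k (U : 'M[R]_(n, k)) (v e : 'cV[R]_n) : mx_injective U ->
  let w := (1%:M - proj_mx_onto U) *m v in
  rss U (v + e) = sqnorm w + 2 * (w^T *m e) 0 0 + rss U e.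
Proof.
move=> iU w; rewrite (rss_sqnorm iU (v + e)) mulmxDr -/w sqnormD -rss_sqnorm//.
congr (_ + 2 * _ 0 0 + _).
have sQ : (1%:M - proj_mx_onto U)^T = 1%:M - proj_mx_onto U.
  by rewrite linearB /= trmx1 proj_mx_onto_sym.
rewrite mulmxA; congr (_ *m _); rewrite /w trmx_mul sQ -mulmxA; congr (_ *m _).
by rewrite mulmxBl mul1mx mulmxBr mulmx1 proj_mx_onto_idem// subrr subr0.
Qed.

Lemma resid_quadE n p (X : 'M[R]_(n, p)) (A A' : {set 'I_p}) (bA : 'cV[R]_#|A|) :
  mx_injective (subcols X A') ->
  resid_quad X A bA A' =
  sqnorm ((1%:M - proj_mx_onto (subcols X A')) *m (subcols X A *m bA)).
Proof. by move=> iU; rewrite -rss_sqnorm// rssE. Qed.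

End RssComparison.

(** * Posterior probabilities in terms of evidences *)

Section Posterior.
Context {R : realType}.
Variables (p : nat) (pw : 'I_p -> R) (pt : nat -> R) (a b : R) (zeta : nat).
Variable A : {set 'I_p}.
Hypotheses (pw0 : forall i, 0 <= pw i).
Hypothesis pt0 : forall k, (0 < k <= p)%N -> 0 <= pt k.
Hypotheses (a0 : 0 < a) (b0 : 0 < b) (pA : 0 < prior_kernel pw pt A).
Hypothesis An0 : A != finset.set0.

Lemma prior_kernel_ge0 S : S != finset.set0 -> 0 <= prior_kernel pw pt S.
Proof.
move=> S0; rewrite !mulr_ge0 ?invr_ge0 ?sumr_ge0//.
by rewrite pt0// card_gt0 S0 -[X in (_ <= X)%N](card_ord p) max_card.
Qed.

Lemma prior_model_ge0 S : S != finset.set0 -> 0 <= prior_model pw pt S.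
Proof.
move=> S0; rewrite divr_ge0 ?prior_kernel_ge0// sumr_ge0// => S' S0'.
exact: prior_kernel_ge0.
Qed.

Lemma prior_model_gt0 : 0 < prior_model pw pt A.
Proof.
rewrite divr_gt0// (bigD1 A)//= ltr_pwDl// sumr_ge0// => S' /andP[S0' _].
exact: prior_kernel_ge0.
Qed.

Section OneSample.
Variables (n : nat) (X : 'M[R]_(n, p)) (y : 'cV[R]_n).
Hypotheses (zn : (zeta < n)%N) (rX : \rank X = p).
Local Notation ev S :=
  (evidence b (n%:R / 2 + a) n #|S| (rss (subcols X S) y) (sqnorm y)).

(** The evidences are finite and positive, hence real numbers [v S], and the common [marg_const]
    cancels in the normalization. *)
Lemma postE : exists2 v : {set 'I_p} -> R,
  forall S, 0 < v S /\ ev S = (v S)%:E &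
  forall S, post a b zeta pw pt X y S =
    prior_model pw pt S * v S /
    \sum_(S' : {set 'I_p} | S' != finset.set0) prior_model pw pt S' * v S'.
Proof.
have n0 : (0 < n)%N by exact: leq_trans zn.
have iX S := subcols_injective (S := S) rX.
have N0 : 0 < n%:R / 2 + a by rewrite addr_gt0 ?divr_gt0 ?ltr0n.
have H (S : {set 'I_p}) : exists v : R, 0 < v /\ ev S = v%:E.
  have [v v0 vE] := evidence_fin b0 N0 #|S| n0 (rss_ge0 (iX S) y) (rss_le _ y).
  by exists v.
have [v vP] := choice H; exists v => // S.
have c0 := marg_const_gt0 a0 b0 n0.
have mE S' : ((prior_model pw pt S')%:E * marg a b zeta X y S')%E =
    (marg_const a b n * (prior_model pw pt S' * v S'))%:E.
  by rewrite margE// (vP S').2 -!EFinM mulrCA.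
rewrite /post mE; under eq_bigr do rewrite mE.
by rewrite sumEFin /= -mulr_sumr -mulf_div divff ?mul1r// gt_eqF.
Qed.

Lemma post_ge0 S : S != finset.set0 -> 0 <= post a b zeta pw pt X y S.
Proof.
move=> S0; have [v vP ->] := postE.
apply: divr_ge0.
  by apply: mulr_ge0; [exact: prior_model_ge0|exact: ltW (vP S).1].
rewrite sumr_ge0// => S' S0'; rewrite mulr_ge0 ?prior_model_ge0//.
by rewrite ltW// (vP S').1.
Qed.

(** The normalizer is bounded below by its term at [A], which has positive prior mass. *)
Lemma post_le (S : {set 'I_p}) (eps : R) : S != finset.set0 ->
  (ev S <= eps%:E * ev A)%E ->
  post a b zeta pw pt X y S <= prior_model pw pt S / prior_model pw pt A * eps.
Proof.
move=> S0; have [v vP ->] := postE; rewrite (vP S).2 (vP A).2 -EFinM lee_fin => H.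
have qA := prior_model_gt0; have vA := (vP A).1.
have qv S' : S' != finset.set0 -> 0 <= prior_model pw pt S' * v S'.
  by move=> S0'; rewrite mulr_ge0 ?prior_model_ge0// ltW// (vP S').1.
have D0 : prior_model pw pt A * v A <=
    \sum_(S' : {set 'I_p} | S' != finset.set0) prior_model pw pt S' * v S'.
  by rewrite (bigD1 A)//= lerDl sumr_ge0// => S' /andP[S0' _]; exact: qv.
have qvA : 0 < prior_model pw pt A * v A by rewrite mulr_gt0.
apply: (@le_trans _ _ (prior_model pw pt S * v S / (prior_model pw pt A * v A))).
  by rewrite ler_wpM2l ?qv// lef_pV2 ?posrE// (lt_le_trans qvA).
rewrite ler_pdivrMr// [leRHS](_ : _ = prior_model pw pt S * (eps * v A)).
  by rewrite ler_wpM2l ?prior_model_ge0.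
by field; rewrite gt_eqF.
Qed.

Lemma post_sum : 1 - post a b zeta pw pt X y A =
  \sum_(S : {set 'I_p} | (S != finset.set0) && (S != A)) post a b zeta pw pt X y S.
Proof.
have [v vP E] := postE.
have D0 : 0 < \sum_(S' : {set 'I_p} | S' != finset.set0) prior_model pw pt S' * v S'.
  rewrite (bigD1 A)//=; apply: ltr_pwDl.
    by rewrite mulr_gt0 ?prior_model_gt0// (vP A).1.
  apply: sumr_ge0 => S' /andP[S0' _].
  by rewrite mulr_ge0 ?prior_model_ge0// ltW// (vP S').1.
under eq_bigr do rewrite E.
set D := (X in 0 < X) in D0; rewrite E -mulr_suml -[1](@divff _ D) ?gt_eqF// /D.
by rewrite -mulrBl {1}(bigD1 A)//= addrAC subrr add0r.
Qed.

End OneSample.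
End Posterior.

(** * Tail bounds for the posterior mass of each wrong model *)

Section Consistency.
Context {R : realType}.
Variables (p : nat) (pw : 'I_p -> R) (pt : nat -> R) (a b : R) (zeta : nat).
Variable X : forall n : nat, 'M[R]_(n, p).
Variables (A : {set 'I_p}) (bA : 'cV[R]_#|A|) (s2 : R).
Hypotheses (pw0 : forall i, 0 <= pw i).
Hypothesis pt0 : forall k, (0 < k <= p)%N -> 0 <= pt k.
Hypotheses (a0 : 0 < a) (b0 : 0 < b) (pA : 0 < prior_kernel pw pt A).
Hypotheses (An0 : A != finset.set0) (s20 : 0 < s2).
Hypothesis design : \forall n \near \oo,
  (forall j, \sum_i (X n i j) ^+ 2 = n%:R - 1) /\ \rank (X n) = p.

Local Notation posterior n e := (post a b zeta pw pt (X n) (subcols (X n) A *m bA + e)).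

Lemma expRN_small (t eps : R) : 0 < t -> 0 < eps ->
  \forall n \near \oo, expR (- (t * n%:R)) < eps.
Proof.
move=> t0 e0; near=> n.
suff : 1 * n.+2%:R ^+ 0 * expR (- (t * n%:R)) < eps by rewrite expr0 !mul1r.
by near: n; exact: poly_expR_small.
Unshelve. all: by end_near. Qed.

Lemma divn_small (c eps : R) : 0 < eps -> \forall n \near \oo, c / n%:R < eps.
Proof.
move=> e0; near=> n.
have n0 : 0 < n%:R :> R by rewrite ltr0n; near: n; exact: nbhs_infty_gt.
rewrite ltr_pdivrMr// mulrC -ltr_pdivrMr//.
by near: n; exact: nbhs_infty_gtr.
Unshelve. all: by end_near. Qed.

(* The [+ 1] covers models of zero prior mass. *)
Lemma post_le_delta (n : nat) (e : 'cV[R]_n) (A' : {set 'I_p}) (delta : R) :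
  A' != finset.set0 -> 0 < delta -> (zeta < n)%N -> \rank (X n) = p ->
  let y := subcols (X n) A *m bA + e in
  (evidence b (n%:R / 2 + a) n #|A'| (rss (subcols (X n) A') y) (sqnorm y) <=
   (delta / (prior_model pw pt A' / prior_model pw pt A + 1))%:E *
   evidence b (n%:R / 2 + a) n #|A| (rss (subcols (X n) A) y) (sqnorm y))%E ->
  `|posterior n e A'| <= delta.
Proof.
move=> A0' d0 zn rX y H.
have q0 : 0 <= prior_model pw pt A' / prior_model pw pt A.
  by rewrite divr_ge0 ?prior_model_ge0.
rewrite ger0_norm ?post_ge0//; apply: le_trans (post_le _ _ _ _ _ _ _ _ _ H) _ => //.
set q := _ / _ in q0 *; rewrite mulrCA ler_piMr ?(ltW d0)//.
by rewrite ler_pdivrMr ?mul1r ?lerDl// ltr_pwDr.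
Qed.

(** Both residuals depend on the noise alone. Off two events of small probability,
    [r - r' <= sqnorm (P' *m e) <= M] and [r' >= n * s2 / 4 - M], which is at least [n * s2 / 8] for
    large [n]. *)
Lemma nested_tail (A' : {set 'I_p}) (delta eta : R) :
  A \subset A' -> A' != A -> 0 < delta -> 0 < eta ->
  \forall n \near \oo,
    gauss_tail s2 (fun e : 'cV[R]_n => delta < `|posterior n e A'|) eta.
Proof.
move=> AA' nA d0 e0.
have kk' : (#|A| < #|A'|)%N.
  by apply: proper_card; rewrite finset.properEneq AA' andbT eq_sym.
have A0' : A' != finset.set0.
  by rewrite -card_gt0; exact: leq_ltn_trans kk'.
set q := prior_model pw pt A' / prior_model pw pt A.
have q0 : 0 <= q by rewrite divr_ge0 ?prior_model_ge0.
have eps0 : 0 < delta / (q + 1) by rewrite divr_gt0// ltr_pwDr.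
(* Makes the Markov bound [16 * s2 * #|A'| / M] equal to [eta / 2]. *)
pose M : R := 32 * s2 * #|A'|%:R / eta.
have k0 : 0 < #|A'|%:R :> R by rewrite ltr0n card_gt0.
have M0 : 0 < M by rewrite !mulr_gt0 ?invr_gt0.
have c0 : 0 < s2 / 8 by rewrite divr_gt0.
have e20 : 0 < eta / 2 by rewrite divr_gt0.
have t0 : 0 < 8^-1 :> R by rewrite invr_gt0.
near=> n.
have zn : (zeta < n)%N by near: n; exact: nbhs_infty_gt.
have [_ rX] : (forall j, \sum_i (X n i j) ^+ 2 = n%:R - 1) /\ \rank (X n) = p.
  by near: n.
have nM : 8 * M / s2 < n%:R by near: n; exact: nbhs_infty_gtr.
have sm : expR (- (8^-1 * n%:R)) < eta / 2 by near: n; exact: expRN_small.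
have iX S := subcols_injective (S := S) rX.
have Hev : forall r s r' : R,
    0 <= r' -> r' <= r -> r <= s -> r - r' <= M -> s2 / 8 * n%:R <= r' ->
    (evidence b (n%:R / 2 + a) n #|A'| r' s <=
     (delta / (q + 1))%:E * evidence b (n%:R / 2 + a) n #|A| r s)%E.
  by near: n; exact: evidence_nested_small (ltW M0) c0 eps0.
set P' := proj_mx_onto (subcols (X n) A').
have T1 := gauss_tail_quad P' s20 M0; rewrite frobenius_proj// in T1.
have T2 := gauss_tail_small n s20.
apply: gauss_tailS (gauss_tailU T1 T2); last first.
  have -> : 16 * s2 * #|A'|%:R / M = eta / 2.
    by rewrite /M; field; rewrite !gt_eqF.
  by move: sm; rewrite (mulrC 8^-1) => /ltW; lra.
move=> e; rewrite ltNge => /negP He; apply: contrapT => /not_orP[].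
move=> /negP; rewrite -ltNge => h1 /negP; rewrite -leNgt => h2; apply: He.
apply: post_le_delta => //.
set y := _ + e; have [C AC] := subcols_sub (X n) AA'.
have E1 : rss (subcols (X n) A) y = rss (subcols (X n) A) e by exact: rss_shift.
have E2 : rss (subcols (X n) A') y = rss (subcols (X n) A') e.
  by rewrite /y AC -mulmxA rss_shift.
have le1 := sqnorm_proj_nested e (iX A) (iX A') AC.
have ge1 := sqnorm_ge0 (proj_mx_onto (subcols (X n) A) *m e).
apply: Hev.
- exact: rss_ge0.
- by rewrite E1 E2 /rss lerD2l lerN2.
- exact: rss_le.
- by rewrite E1 E2 /rss -/P'; move: h1 le1 ge1; rewrite -/P'; lra.
rewrite E2 /rss -/P'; move: nM h1 h2; rewrite ltr_pdivrMr//; lra.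
Unshelve. all: by end_near. Qed.

(** Three events are excluded, each at cost [eta / 3]: a noise of squared norm at least [C * n], a
    cross term [w^T e] of size at least [d * n], and a projected noise of squared norm at least
    [d * n]. Outside them the residual gap is linear in [n]. *)
Lemma nonnested_tail (A' : {set 'I_p}) (delta eta bA' : R) :
  A' != finset.set0 -> 0 < bA' ->
  (fun n : nat => resid_quad (X n) A bA A' / n%:R) @ \oo --> bA' ->
  0 < delta -> 0 < eta ->
  \forall n \near \oo,
    gauss_tail s2 (fun e : 'cV[R]_n => delta < `|posterior n e A'|) eta.
Proof.
move=> A0' B0 cvgB d0 e0.
set q := prior_model pw pt A' / prior_model pw pt A.
have q0 : 0 <= q by rewrite divr_ge0 ?prior_model_ge0.
have eps0 : 0 < delta / (q + 1) by rewrite divr_gt0// ltr_pwDr.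
have e30 : 0 < eta / 3 by rewrite divr_gt0.
(* Makes the Markov bound [16 * s2 * n / (C * n)] equal to [eta / 3]. *)
pose C : R := 48 * s2 / eta.
have C0 : 0 < C by rewrite !mulr_gt0 ?invr_gt0.
pose Cm : R := #|A|%:R * sqnorm bA.
have Cm0 : 0 <= Cm by rewrite mulr_ge0 ?sqnorm_ge0.
(* Eventually [sqnorm w > n * bA' / 2 = 6 * d * n]; the cross term takes away at most [2 * d * n]
   and the projected noise [d * n], leaving a gap of [3 * d * n]. *)
pose d := bA' / 12.
have dd0 : 0 < d by rewrite divr_gt0.
have CC0 : 0 <= 2 * Cm + 2 * C by move: C0 Cm0; lra.
have d30 : 0 < 3 * d by rewrite mulr_gt0.
near=> n.
have zn : (zeta < n)%N by near: n; exact: nbhs_infty_gt.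
have n0 : (0 < n)%N by exact: leq_trans zn.
have nn0 : 0 < n%:R :> R by rewrite ltr0n.
have [nX rX] : (forall j, \sum_i (X n i j) ^+ 2 = n%:R - 1) /\ \rank (X n) = p.
  by near: n.
have iX S := subcols_injective (S := S) rX.
have s1 : 16 * s2 * (2 * bA') / d ^+ 2 / n%:R < eta / 3 by near: n; exact: divn_small.
have s3 : 16 * s2 * #|A'|%:R / d / n%:R < eta / 3 by near: n; exact: divn_small.
have rlo : bA' / 2 < resid_quad (X n) A bA A' / n%:R.
  by near: n; apply: (cvgr_gt _ cvgB); rewrite ltr_pdivrMr// ltr_pMr// ltr1n.
have rhi : resid_quad (X n) A bA A' / n%:R < 2 * bA'.
  by near: n; apply: (cvgr_lt _ cvgB); rewrite ltr_pMl// ltr1n.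
have Hev : forall r s r' : R,
    0 <= r -> r <= s -> r' <= s -> s <= (2 * Cm + 2 * C) * n%:R ->
    r + 3 * d * n%:R <= r' ->
    (evidence b (n%:R / 2 + a) n #|A'| r' s <=
     (delta / (q + 1))%:E * evidence b (n%:R / 2 + a) n #|A| r s)%E.
  by near: n; exact: evidence_nonnested_small CC0 d30 eps0.
set P' := proj_mx_onto (subcols (X n) A').
pose v := subcols (X n) A *m bA; pose w := (1%:M - P') *m v.
have rE : resid_quad (X n) A bA A' = sqnorm w by exact: resid_quadE.
have Cn0 : 0 < C * n%:R by rewrite mulr_gt0.
have dn0 : 0 < d * n%:R by rewrite mulr_gt0.
have dn20 : 0 < (d * n%:R) ^+ 2 by rewrite exprn_gt0.
have T1 := gauss_tail_quad (1%:M : 'M[R]_n) s20 Cn0.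
have T2 := gauss_tail_quad w^T s20 dn20.
have T3 := gauss_tail_quad P' s20 dn0; rewrite frobenius_proj// in T3.
apply: gauss_tailS (gauss_tailU T1 (gauss_tailU T2 T3)); last first.
  have -> : \sum_(i < n) \sum_(j < n) ((1%:M : 'M[R]_n) i j) ^+ 2 = n%:R.
    rewrite -[X in _ = X%:R]card_ord -sumr_const; apply: eq_bigr => i _.
    rewrite (bigD1 i)//= big1 ?addr0 ?mxE ?eqxx ?expr1n// => j /negbTE ji.
    by rewrite mxE eq_sym ji expr0n.
  have -> : \sum_(i < 1) \sum_(j < n) (w^T i j) ^+ 2 = sqnorm w.
    by rewrite big_ord1; apply: eq_bigr => j _; rewrite mxE.
  have -> : 16 * s2 * n%:R / (C * n%:R) = eta / 3.
    by rewrite /C; field; rewrite !gt_eqF.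
  have u2 : 16 * s2 * sqnorm w / (d * n%:R) ^+ 2 <= eta / 3.
    apply: le_trans (ltW s1).
    move: rhi; rewrite rE ltr_pdivrMr// => /ltW rhi.
    have z0 : 0 <= 16 * s2 / (d * n%:R) ^+ 2.
      by apply: divr_ge0; [apply: mulr_ge0 => //; exact: ltW|exact: ltW].
    have := ler_wpM2l z0 rhi.
    rewrite (_ : 16 * s2 / (d * n%:R) ^+ 2 * sqnorm w = 16 * s2 * sqnorm w / (d * n%:R) ^+ 2); last by ring.
    rewrite (_ : 16 * s2 / (d * n%:R) ^+ 2 * (2 * bA' * n%:R) = 16 * s2 * (2 * bA') / d ^+ 2 / n%:R)//.
    by field; rewrite !gt_eqF.
  have u3 : 16 * s2 * #|A'|%:R / (d * n%:R) <= eta / 3.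
    by apply: le_trans (ltW s3); rewrite invfM mulrA.
  by move: u2 u3; lra.
move=> e; rewrite ltNge => /negP He; apply: contrapT => /not_orP[].
move=> /negP; rewrite -ltNge mul1mx => h1 /not_orP[].
move=> /negP; rewrite -ltNge => h2 /negP; rewrite -ltNge => h3; apply: He.
apply: post_le_delta => //; set y := _ + e.
have E1 : rss (subcols (X n) A) y = rss (subcols (X n) A) e by exact: rss_shift.
have E2 : rss (subcols (X n) A') y = sqnorm w + 2 * (w^T *m e) 0 0 + rss (subcols (X n) A') e.
  exact: rss_signal.
have vn : sqnorm v <= Cm * n%:R.
  apply: sqnorm_mulmx_le => j; rewrite (eq_bigr (fun i => X n i (enum_val j) ^+ 2)).
    by rewrite nX gerBl.
  by move=> i _; rewrite mxE.
apply: Hev.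
- exact: rss_ge0.
- exact: rss_le.
- exact: rss_le.
- by apply: le_trans (sqnormD_le _ _) _; rewrite -/v; lra.
have h4 := rss_le (subcols (X n) A) e.
have h5 : - (d * n%:R) <= (w^T *m e) 0 0.
  have h6 : ((w^T *m e) 0 0) ^+ 2 <= (d * n%:R) ^+ 2.
    by apply: le_trans (ltW h2); rewrite /sqnorm big_ord1.
  by rewrite leNgt; apply/negP => hx; move: h6 dn0 hx; set D := d * _; set x := (_ *m e) 0 0; nra.
have h7 : 6 * (d * n%:R) < sqnorm w.
  by move: rlo; rewrite rE ltr_pdivlMr// /d; lra.
rewrite E1 E2 {2}/rss -/P'; move: h3 h4 h5 h7; lra.
Unshelve. all: by end_near. Qed.

End Consistency.

(** * From tail bounds to limits in probability *)

Lemma gauss_prob_cvg0 (R : realType) (s2 : R) (Z : forall n, 'cV[R]_n -> bool) :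
  (forall eta : R, 0 < eta ->
     \forall n \near \oo, gauss_tail s2 (fun e : 'cV[R]_n => Z n e) eta) ->
  (fun n => gauss_prob s2 (Z n)) @ \oo --> 0%:E.
Proof.
move=> H; apply/fine_cvgP; split.
  (* The tail bound at level 1 shows that the probabilities are eventually finite. *)
  near=> n; have /gauss_prob_tail/andP[h0 h1] : gauss_tail s2 (fun e => Z n e) 1.
    by near: n; exact: H.
  by rewrite ge0_fin_numE//; apply: le_lt_trans h1 _; rewrite ltry.
apply/cvgrPdist_le => eta eta0; near=> n.
have /gauss_prob_tail/andP[h0 h1] : gauss_tail s2 (fun e => Z n e) eta.
  by near: n; exact: H.
have fin : gauss_prob s2 (Z n) \is a fin_num.
  by rewrite ge0_fin_numE//; apply: le_lt_trans h1 _; rewrite ltry.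
by rewrite sub0r normrN ger0_norm ?fine_ge0// -lee_fin fineK.
Unshelve. all: by end_near. Qed.

Lemma gauss_tail_False (R : realType) (n : nat) (s2 eta : R) : 0 <= eta ->
  gauss_tail s2 (fun _ : 'cV[R]_n => False) eta.
Proof.
move=> eta0; exists (fun=> 0); split=> //.
have [n0 E0] := @iint_nice0 R n.
have Ef : (fun e : 'cV[R]_n => (gauss_pdf s2 e * 0)%:E) = (fun=> 0%E).
  by apply/funext => e; rewrite mulr0.
by split; rewrite ?Ef ?E0.
Qed.

Theorem theorem1 (R : realType) (p : nat)
  (pw : 'I_p -> R) (pt : nat -> R) (a b : R) (zeta : nat)
  (X : forall n : nat, 'M[R]_(n, p))
  (A : {set 'I_p}) (bA : 'cV[R]_#|A|) (sigma2 : R) :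
  (* hyperparameters *)
  (forall i, 0 <= pw i) -> \sum_i pw i = 1 ->
  (forall k, (0 < k <= p)%N -> 0 <= pt k) ->
  0 < a -> 0 < b ->
  (* the true model has positive prior mass *)
  0 < prior_kernel pw pt A ->
  (* design: centered columns with squared norm n-1, full column rank *)
  (exists N : nat, forall n : nat, (N <= n)%N ->
     [/\ forall j, \sum_i X n i j = 0,
         forall j, \sum_i (X n i j) ^+ 2 = n%:R - 1
       & \rank (X n) = p]) ->
  (* true model *)
  A != finset.set0 -> 0 < sigma2 ->
  (* identifiability condition for all non-nesting models *)
  (forall A' : {set 'I_p}, A' != finset.set0 -> ~~ (A \subset A') ->
     exists2 bA' : R, 0 < bA' &
       (fun n : nat => resid_quad (X n) A bA A' / n%:R) @ \oo --> bA') ->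
  (* consistency: plim p(M_A | y, X) = 1 *)
  (forall delta : R, 0 < delta ->
     (fun n : nat => gauss_prob sigma2 (fun e : 'cV[R]_n =>
        delta < `| post a b zeta pw pt (X n) (subcols (X n) A *m bA + e) A - 1 |))
     @ \oo --> 0%:E) /\
  (* and plim p(M_A' | y, X) = 0 for every nonempty A' <> A *)
  (forall A' : {set 'I_p}, A' != finset.set0 -> A' != A ->
   forall delta : R, 0 < delta ->
     (fun n : nat => gauss_prob sigma2 (fun e : 'cV[R]_n =>
        delta < `| post a b zeta pw pt (X n) (subcols (X n) A *m bA + e) A' |))
     @ \oo --> 0%:E).
Proof.
move=> pw0 _ pt0 a0 b0 pA [N0 HN0] An0 s20 ident.
have design : \forall n \near \oo,
    (forall j, \sum_i (X n i j) ^+ 2 = n%:R - 1) /\ \rank (X n) = p.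
  by exists N0 => // n /= /HN0[_ h1 h2].
have tail A' delta eta : A' != finset.set0 -> A' != A -> 0 < delta -> 0 < eta ->
    \forall n \near \oo, gauss_tail sigma2 (fun e : 'cV[R]_n =>
      delta < `|post a b zeta pw pt (X n) (subcols (X n) A *m bA + e) A'|) eta.
  move=> A0' nA d0 e0; have [AA'|nAA'] := boolP (A \subset A').
    exact: nested_tail.
  by have [B B0 cvgB] := ident A' A0' nAA'; exact: nonnested_tail cvgB _ _.
split=> [delta d0|A' A0' nA delta d0]; last first.
  by apply: gauss_prob_cvg0 => eta e0; exact: tail.
apply: gauss_prob_cvg0 => eta e0.
(* If the competitors of [A] together have mass above [delta], one of them has mass above
   [delta / K]; the union bound shares [eta] among the [K] subsets likewise. *)
pose K : R := #|{set 'I_p}|%:R.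
have K0 : 0 < K by rewrite ltr0n; apply/card_gt0P; exists A.
have dK0 : 0 < delta / K by rewrite divr_gt0.
have eK0 : 0 < eta / K by rewrite divr_gt0.
(* The side conditions make the event empty for the empty set and for [A], so that the union can run
   over all subsets. *)
pose Z n (S : {set 'I_p}) (e : 'cV[R]_n) := [/\ S != finset.set0, S != A &
  delta / K < `|post a b zeta pw pt (X n) (subcols (X n) A *m bA + e) S|].
have tails S : \forall n \near \oo, gauss_tail sigma2 (Z n S) (eta / K).
  have [/andP[S0 SA]|nS] := boolP ((S != finset.set0) && (S != A)).
    apply: filterS (tail S _ _ S0 SA dK0 eK0) => n.
    by apply: gauss_tailS => // e [].
  apply: nearW => n; apply: gauss_tailS (gauss_tail_False n sigma2 (ltW eK0)) => // e [S0 SA _].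
  by rewrite S0 SA in nS.
have {}tails : \forall n \near \oo, forall S, gauss_tail sigma2 (Z n S) (eta / K).
  exact: filter_forall.
near=> n.
have zn : (zeta < n)%N by near: n; exact: nbhs_infty_gt.
have [_ rX] : (forall j, \sum_i (X n i j) ^+ 2 = n%:R - 1) /\ \rank (X n) = p.
  by near: n.
have Tn : forall S, gauss_tail sigma2 (Z n S) (eta / K) by near: n.
apply: gauss_tailS (gauss_tail_exists Tn); last first.
  by rewrite sumr_const -mulr_natr divfK// gt_eqF.
move=> e; set y := _ + e; rewrite ltNge => /negP He; apply: contrapT => nZ; apply: He.
rewrite distrC (post_sum pw0 pt0 a0 b0 pA An0 y zn rX).
apply: le_trans (ler_norm_sum _ _ _) _.
apply: (@le_trans _ _ (\sum_(S : {set 'I_p}) delta / K)); last first.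
  by rewrite sumr_const -mulr_natr divfK// gt_eqF.
rewrite [leRHS](bigID (fun S => (S != finset.set0) && (S != A)))/=.
rewrite -[leLHS]addr0; apply: lerD; last by apply: sumr_ge0 => S _; exact: ltW.
apply: ler_sum => S /andP[S0 SA]; rewrite leNgt; apply/negP => h.
by apply: nZ; exists S.
Unshelve. all: by end_near. Qed.
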